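(* The reduced equations of the rubber Chaplygin ball rolling over a sphere, $\dot\gamma=X_\gamma(p,\gamma)$, $\dot p=X_p(p,\gamma)$ on $T^*S^{n-1}=\{(p,\gamma)\in\mathbb R^{2n}\mid(\gamma,\gamma)=1,\ (\gamma,p)=0\}$, where $X_\gamma$ is the inverse of the Legendre transformation $p=-\frac1{\epsilon^2}\mathbf I(\gamma\wedge\dot\gamma)\gamma$ and $$X_p=\frac{1-\epsilon}{\epsilon^3}\big(\mathbf I(\gamma\wedge X_\gamma)\big)X_\gamma+\Big(\frac{\epsilon-1}{\epsilon^3}\big((\mathbf I(\gamma\wedge X_\gamma))X_\gamma,\gamma\big)-(X_\gamma,p)\Big)\gamma,$$ have the invariant measure $$\big(\det\mathbf I|_{\mathfrak v_\gamma}\big)^{\frac1{2\epsilon}-1}\,\mathbf w^{n-1},$$ where $\mathbf w=dp_1\wedge d\gamma_1+\dots+dp_n\wedge d\gamma_n\,|_{T^*S^{n-1}}$ is the canonical symplectic form.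
   Context: Vectors of $\mathbb R^n$ are columns, $(x,y)=x^Ty$, $x\otimes y=xy^T$, $x\wedge y=xy^T-yx^T$. Identify $so(n)\cong so(n)^*$ by $\langle X,Y\rangle=-\frac12\mathrm{tr}(XY)$. $\mathbf I=\mathbb I+D\mathbb E$, where $\mathbb I:so(n)\to so(n)$ is symmetric positive definite, $\mathbb E$ is the identity operator and $D>0$ is a constant. $\epsilon=\sigma/(\sigma\pm\rho)$ is a nonzero real constant, where $\rho>0$ is the radius of the rolling ball and $\sigma>0$ that of the fixed sphere (sign $+$ for rolling over the outer surface; sign $-$, with $\sigma\ne\rho$, for rolling over the inner surface or for a shell rolling around the fixed sphere in its interior). The inverse Legendre transformation $X_\gamma(p,\gamma)$ is the unique $\dot\gamma\in T_\gamma S^{n-1}$ with $p=-\frac1{\epsilon^2}\mathbf I(\gamma\wedge\dot\gamma)\gamma$. For $\gamma\in S^{n-1}$, $\mathfrak v_\gamma=\mathbb R^n\wedge\gamma\subset so(n)$, with orthogonal projection $\mathrm{pr}_{\mathfrak v_\gamma}\xi=\xi\,\gamma\otimes\gamma+\gamma\otimes\gamma\,\xi$. $\det\mathbf I|_{\mathfrak v_\gamma}$ is the determinant of the restriction of the quadratic form of $\mathbf I$ to $\mathfrak v_\gamma$, i.e. of $\mathrm{pr}_{\mathfrak v_\gamma}\circ\mathbf I|_{\mathfrak v_\gamma}:\mathfrak v_\gamma\to\mathfrak v_\gamma$. ''Has an invariant measure'' given by a volume form means that the flow preserves that volume form. *)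

(* Defs.v *)
From HB Require Import structures.
From mathcomp Require Import all_boot all_order all_algebra all_fingroup.
From mathcomp Require Import all_classical all_reals all_analysis.

Set Implicit Arguments.
Unset Strict Implicit.
Unset Printing Implicit Defensive.

Import Order.TTheory GRing.Theory Num.Theory.
Import numFieldNormedType.Exports.

Local Open Scope classical_set_scope.
Local Open Scope ring_scope.

Definition dotv (R : realType) (n : nat) (x y : 'cV[R]_n) : R :=
  (x^T *m y) 0 0.

Definition tensv (R : realType) (n : nat) (x y : 'cV[R]_n) : 'M[R]_n :=
  x *m y^T.

Definition wedgev (R : realType) (n : nat) (x y : 'cV[R]_n) : 'M[R]_n :=
  tensv x y - tensv y x.

Definition so (R : realType) (n : nat) : set 'M[R]_n :=
  [set A | A^T = - A].

Definition so_dot (R : realType) (n : nat) (A B : 'M[R]_n) : R :=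
  - (2^-1 * \tr (A *m B)).

(* An operator on so(n) is encoded by a linear map on all matrices; only its
   values on so(n) are ever constrained or used. *)
Definition inertia_operator (R : realType) (n : nat)
    (J : {linear 'M[R]_n -> 'M[R]_n}) : Prop :=
  [/\ forall A, so A -> so (J A),
      forall A B, so A -> so B -> so_dot (J A) B = so_dot A (J B)
    & forall A, so A -> A != 0 -> 0 < so_dot (J A) A].

Definition shifted_inertia (R : realType) (n : nat)
    (J : {linear 'M[R]_n -> 'M[R]_n}) (D : R) (A : 'M[R]_n) : 'M[R]_n :=
  J A + D *: A.

Definition rolling_ratio (R : realType) (rho sigma eps : R) : Prop :=
  eps = sigma / (sigma + rho) \/
  (sigma != rho /\ eps = sigma / (sigma - rho)).

(* Points of the phase space and vectors tangent to it are pairs in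
   'cV[R]_n * 'cV[R]_n, momentum component first. *)
Definition cotangent_sphere (R : realType) (n : nat) :
    set ('cV[R]_n * 'cV[R]_n) :=
  [set m | dotv m.2 m.2 = 1 /\ dotv m.2 m.1 = 0].

(* Kernel of the differential at m of the two constraints above. *)
Definition tangent_cotangent_sphere (R : realType) (n : nat)
    (m : 'cV[R]_n * 'cV[R]_n) : set ('cV[R]_n * 'cV[R]_n) :=
  [set v | dotv m.2 v.2 = 0 /\ dotv v.2 m.1 + dotv m.2 v.1 = 0].

Definition legendre (R : realType) (n : nat) (I : 'M[R]_n -> 'M[R]_n)
    (eps : R) (gamma x : 'cV[R]_n) : 'cV[R]_n :=
  - (eps ^+ 2)^-1 *: (I (wedgev gamma x) *m gamma).

(* The x tangent to the sphere at gamma whose Legendre transform is p. *)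
Definition X_gamma (R : realType) (n : nat) (I : 'M[R]_n -> 'M[R]_n)
    (eps : R) (p gamma : 'cV[R]_n) : 'cV[R]_n :=
  get [set x | dotv gamma x = 0 /\ p = legendre I eps gamma x].

Definition X_p (R : realType) (n : nat) (I : 'M[R]_n -> 'M[R]_n)
    (eps : R) (p gamma : 'cV[R]_n) : 'cV[R]_n :=
  let x := X_gamma I eps p gamma in
  let u := I (wedgev gamma x) *m x in
  ((1 - eps) / eps ^+ 3) *: u
  + ((eps - 1) / eps ^+ 3 * dotv u gamma - dotv x p) *: gamma.

Definition rubber_ball_field (R : realType) (n : nat)
    (I : 'M[R]_n -> 'M[R]_n) (eps : R) (m : 'cV[R]_n * 'cV[R]_n) :
    'cV[R]_n * 'cV[R]_n :=
  (X_p I eps m.1 m.2, X_gamma I eps m.1 m.2).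

Definition wedge_with (R : realType) (n : nat) (gamma x : 'cV[R]_n) :
    'M[R]_n := wedgev x gamma.

Fact wedge_with_is_linear (R : realType) (n : nat) (gamma : 'cV[R]_n) :
  linear (wedge_with gamma).
Proof.
move=> a x y; rewrite /wedge_with /wedgev /tensv linearP /= mulmxDl mulmxDr.
by rewrite -scalemxAl -scalemxAr scalerBr opprD addrACA.
Qed.

HB.instance Definition _ (R : realType) (n : nat) (gamma : 'cV[R]_n) :=
  GRing.isLinear.Build R 'cV[R]_n 'M[R]_n *:%R (wedge_with gamma)
    (@wedge_with_is_linear R n gamma).

Definition v_space (R : realType) (n : nat) (gamma : 'cV[R]_n) :
    {vspace 'M[R]_n} :=
  limg (linfun (wedge_with gamma)).

Definition pr_v (R : realType) (n : nat) (gamma : 'cV[R]_n) (A : 'M[R]_n) :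
    'M[R]_n :=
  A *m tensv gamma gamma + tensv gamma gamma *m A.

(* Determinant of a linear endomorphism f of the subspace U, computed in the
   basis vbasis U. *)
Definition det_on (R : realType) (vT : vectType R) (U : {vspace vT})
    (f : vT -> vT) : R :=
  \det (\matrix_(i < \dim U, j < \dim U)
          coord (vbasis U) j (f (vbasis U)`_i)).

Definition det_v (R : realType) (n : nat) (I : 'M[R]_n -> 'M[R]_n)
    (gamma : 'cV[R]_n) : R :=
  det_on (v_space gamma) (pr_v gamma \o I).

Definition form (R : realType) (V : Type) (k : nat) : Type :=
  ('I_k -> V) -> R.

(* Normalised so that (a /\ b) (u, v) = a u * b v - a v * b u for 1-forms. *)
Definition wedge_form (R : realType) (V : Type) (k l : nat)
    (a : form R V k) (b : form R V l) : form R V (k + l) :=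
  fun v => (k`!%:R * l`!%:R)^-1 *
    \sum_(s : 'S_(k + l)) (-1) ^+ s *
      (a (fun i => v (s (lshift l i))) * b (fun j => v (s (rshift k j)))).

Fixpoint wedge_power (R : realType) (V : Type) (k : nat) (a : form R V k)
    (m : nat) : form R V (m * k) :=
  match m return form R V (m * k) with
  | 0 => fun=> 1
  | m'.+1 => wedge_form a (@wedge_power R V k a m')
  end.

Arguments wedge_power {R V k} a m v.

Definition dp (R : realType) (n : nat) (i : 'I_n) :
    form R ('cV[R]_n * 'cV[R]_n) 1 :=
  fun v => (v 0).1 i 0.

Definition dgamma (R : realType) (n : nat) (i : 'I_n) :
    form R ('cV[R]_n * 'cV[R]_n) 1 :=
  fun v => (v 0).2 i 0.

Definition symplectic_form (R : realType) (n : nat) :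
    form R ('cV[R]_n * 'cV[R]_n) 2 :=
  fun v => \sum_(i < n) wedge_form (@dp R n i) (@dgamma R n i) v.

Definition chaplygin_volume (R : realType) (n : nat)
    (I : 'M[R]_n -> 'M[R]_n) (eps : R) (m : 'cV[R]_n * 'cV[R]_n) :
    form R ('cV[R]_n * 'cV[R]_n) (n.-1 * 2) :=
  fun v => det_v I m.2 `^ ((2 * eps)^-1 - 1)
           * wedge_power (@symplectic_form R n) n.-1 v.

Definition C1_on (R : realType) (U V : normedModType R) (W : set U)
    (f : U -> V) : Prop :=
  forall z, W z -> differentiable f z /\
    forall h, {for z, continuous (fun z' => 'd f z' h)}.

(* phi (t, m) is the point reached at time t from m. The flow lives on the
   submanifold M; as usual for maps on a submanifold, being C^1 means being
   the restriction of a C^1 map on an open set W of the ambient space. The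
   values of phi at points (t, m) with m outside M play no other role. *)
Record local_flow (R : realType) (V : normedModType R) (M : set V)
    (X : V -> V) (W : set (R * V)) (phi : R * V -> V) : Prop := LocalFlow {
  flow_open : open W;
  flow_C1 : C1_on W phi;
  flow_interval : forall t m, M m -> W (t, m) ->
    forall a, 0 <= a <= 1 -> W (a * t, m);
  flow_mem : forall t m, M m -> W (t, m) -> M (phi (t, m));
  flow_init : forall m, M m -> W (0, m) -> phi (0, m) = m;
  flow_ode : forall t m, M m -> W (t, m) ->
    is_derive t 1 (fun s : R => phi (s, m)) (X (phi (t, m)))
}.

(* Omega m is a k-form on the tangent space T m of M, and the flow preserves
   Omega when its time-t maps pull Omega back to itself wherever defined. *)
Definition flow_preserves (R : realType) (V : normedModType R) (M : set V)
    (T : V -> set V) (X : V -> V) (k : nat) (Omega : V -> form R V k) : Prop :=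
  forall (W : set (R * V)) (phi : R * V -> V), local_flow M X W phi ->
  forall t m, M m -> W (t, m) ->
  forall v : 'I_k -> V, (forall i, T m (v i)) ->
    Omega (phi (t, m)) (fun i => 'd (fun x => phi (t, x)) m (v i))
    = Omega m v.

(* Main.v *)
(* Let x = X_gamma and let E be an orthonormal frame of the tangent space of the
   sphere at gamma. In the coordinates (E^T p, E^T gamma) of tangent vectors the
   symplectic form is standard, so w^(n-1) of the transported vectors is a
   constant times the determinant of their coordinate matrix C. By the
   interchange of partial derivatives C satisfies the linearized equation
   C' = C Z with tr Z = ((1 - 2 eps) / eps) tr (Q B^-1), where B is the matrix of
   I restricted to v_gamma in the frame and Q_ij = (e_i, I(gamma /\ e_j) x). On
   the other hand det I|_(v_gamma) = det B and B' = - (Q + Q^T), so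
   (log det B)' = - 2 tr (Q B^-1), and the exponent 1 / (2 eps) - 1 makes the
   two contributions cancel. *)

(* The interchange works because the time derivative is the field itself: on phase space it is a
   rational expression of the point, so its parameter derivative exists as a limit taken jointly
   with time, and the mean value theorem in time does the rest. The equation of motion is known on
   the submanifold only, so each tangent vector is realized by a curve inside it. [X_gamma] is a
   choice with no regularity of its own and is replaced by Cramer's rule.

   A sphere need not carry a global orthonormal tangent frame. A new frame is therefore started at
   every instant and carried along by rotations; its derivative at that instant is normal to the
   sphere, so it leaves no trace in the derivative of the reduced inertia, and in the coordinates C
   it adds only the normal component of the momentum variation, which ends up off the diagonal of
   Z. *)
From HB Require Import structures.
From mathcomp Require Import all_boot all_order all_algebra all_fingroup.
From mathcomp Require Import all_classical all_reals all_analysis.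
From mathcomp Require Import ring lra.
Require Import Defs.

Set Implicit Arguments.
Unset Strict Implicit.
Unset Printing Implicit Defensive.

Import Order.TTheory GRing.Theory Num.Theory.
Import numFieldNormedType.Exports.
Local Open Scope classical_set_scope.
Local Open Scope ring_scope.

(** * Difference quotients along a filter *)

(* A way of taking difference quotients on P: the quotient is that of the
   values at inc_to t and inc_from t by inc_step t, in the limit along inc_F.
   It covers both the time derivative and the derivative with respect to a
   parameter, uniformly in time. *)
Record increment (R : realType) (P : Type) := Increment {
  inc_T : Type;
  inc_F : set_system inc_T;
  inc_filter : ProperFilter inc_F;
  inc_to : inc_T -> P;
  inc_from : inc_T -> P;
  inc_step : inc_T -> R
}.
#[global] Existing Instance inc_filter.
Arguments inc_F {R P} i.
Arguments inc_to {R P} i t : rename.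
Arguments inc_from {R P} i t : rename.
Arguments inc_step {R P} i t : rename.

Section Slopes.
Variables (R : realType) (P : Type) (d : increment R P).
Local Notation F := (@inc_F R P d).
Local Notation z1 := (@inc_to R P d).
Local Notation z0 := (@inc_from R P d).
Local Notation dt := (@inc_step R P d).

(** Both end points may move along the filter when a parameter is varied, so the limits of the
    values are part of the notion; the product and inverse rules rely on them. *)
Definition has_slope (h : P -> R) (l b : R) : Prop :=
  [/\ h (z1 t) @[t --> F] --> l, h (z0 t) @[t --> F] --> l
    & (h (z1 t) - h (z0 t)) / dt t @[t --> F] --> b].

(** This is how an identity is differentiated: its two sides agree along the filter, and their
    slopes are computed by different rules. *)
Lemma has_slope_uniq h k l b l' b' :
  (\forall t \near F, h (z1 t) = k (z1 t) /\ h (z0 t) = k (z0 t)) ->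
  has_slope h l b -> has_slope k l' b' -> l = l' /\ b = b'.
Proof.
move=> hk [h1 h2 h3] [k1 k2 k3]; split.
  apply: (cvg_unique _ h1).
  - exact: Rhausdorff.
  - apply: cvg_trans k1; apply: near_eq_cvg.
    by apply: filterS hk => t [].
apply: (cvg_unique _ h3).
- exact: Rhausdorff.
- apply: cvg_trans k3; apply: near_eq_cvg.
  by apply: filterS hk => t [-> ->].
Qed.

Lemma has_slope_near h k l b :
  (\forall t \near F, h (z1 t) = k (z1 t) /\ h (z0 t) = k (z0 t)) ->
  has_slope h l b -> has_slope k l b.
Proof.
move=> hk [h1 h2 h3]; split.
- by apply: cvg_trans h1; apply: near_eq_cvg; apply: filterS hk => t [].
- by apply: cvg_trans h2; apply: near_eq_cvg; apply: filterS hk => t [].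
- by apply: cvg_trans h3; apply: near_eq_cvg; apply: filterS hk => t [-> ->].
Qed.

Lemma has_slope_eq h l b l' b' :
  has_slope h l b -> l = l' -> b = b' -> has_slope h l' b'.
Proof. by move=> ? <- <-. Qed.

Lemma has_slope_cst c : has_slope (fun=> c) c 0.
Proof.
split; [exact: cvg_cst | exact: cvg_cst | ].
rewrite (_ : (fun t => _) = cst 0); first exact: cvg_cst.
by apply/funext => t; rewrite subrr mul0r.
Qed.

Lemma has_slopeD h k l b l' b' : has_slope h l b -> has_slope k l' b' ->
  has_slope (fun z => h z + k z) (l + l') (b + b').
Proof.
move=> [h1 h2 h3] [k1 k2 k3]; split; [exact: cvgD|exact: cvgD|].
rewrite (_ : (fun t => _) =
  (fun t => (h (z1 t) - h (z0 t)) / dt t + (k (z1 t) - k (z0 t)) / dt t)).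
  exact: cvgD.
by apply/funext => t; rewrite -mulrDl opprD addrACA.
Qed.

Lemma has_slopeM h k l b l' b' : has_slope h l b -> has_slope k l' b' ->
  has_slope (fun z => h z * k z) (l * l') (b * l' + l * b').
Proof.
move=> [h1 h2 h3] [k1 k2 k3]; split; [exact: cvgM|exact: cvgM|].
rewrite (_ : (fun t => _) =
  (fun t => (h (z1 t) - h (z0 t)) / dt t * k (z1 t) +
            h (z0 t) * ((k (z1 t) - k (z0 t)) / dt t))).
  by apply: cvgD; apply: cvgM.
apply/funext => t; rewrite mulrAC mulrA -mulrDl; congr (_ * _).
by rewrite mulrBl mulrBr addrA subrK.
Qed.

Lemma has_slopeZ c h l b : has_slope h l b ->
  has_slope (fun z => c * h z) (c * l) (c * b).
Proof.
move=> hh; apply: has_slope_eq (has_slopeM (has_slope_cst c) hh) _ _ => //.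
by rewrite mul0r add0r.
Qed.

Lemma has_slopeN h l b : has_slope h l b ->
  has_slope (fun z => - h z) (- l) (- b).
Proof.
move=> /(has_slopeZ (-1)); rewrite !mulN1r.
by under [X in has_slope X]funext do rewrite mulN1r.
Qed.

Lemma has_slopeV h l b : l != 0 -> has_slope h l b ->
  has_slope (fun z => (h z)^-1) l^-1 (- (b / l ^+ 2)).
Proof.
move=> l0 [h1 h2 h3]; split; [exact: cvgV|exact: cvgV|].
have : - ((h (z1 t) - h (z0 t)) / dt t * ((h (z1 t))^-1 * (h (z0 t))^-1))
    @[t --> F] --> - (b / l ^+ 2).
  apply: cvgN; apply: cvgM => //.
  by rewrite expr2 invfM; apply: cvgM; apply: cvgV.
apply: cvg_trans; apply: near_eq_cvg.
apply: filterS2 (cvgr_neq0 l h1 l0) (cvgr_neq0 l h2 l0) => t ne1 ne0.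
rewrite mulrAC -mulNr; congr (_ * _).
by rewrite mulrBl mulrA divff// mul1r mulrCA divff// mulr1 opprB.
Qed.

Lemma has_slope_sum I (r : seq I) (p : pred I) (h : I -> P -> R) l b :
  (forall i, p i -> has_slope (h i) (l i) (b i)) ->
  has_slope (fun z => \sum_(i <- r | p i) h i z) (\sum_(i <- r | p i) l i)
    (\sum_(i <- r | p i) b i).
Proof.
move=> H; elim: r => [|i r IH].
  rewrite !big_nil; under [X in has_slope X]funext do rewrite big_nil.
  exact: has_slope_cst.
rewrite !big_cons; under [X in has_slope X]funext do rewrite big_cons.
by case: ifPn => // pi; apply: has_slopeD => //; apply: H.
Qed.

Lemma has_slope_prod (I : finType) (h : I -> P -> R) l b :
  (forall i, has_slope (h i) (l i) (b i)) ->
  has_slope (fun z => \prod_i h i z) (\prod_i l i)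
    (\sum_i b i * \prod_(j | j != i) l j).
Proof.
move=> H; suff: forall r : seq I, uniq r ->
    has_slope (fun z => \prod_(i <- r) h i z) (\prod_(i <- r) l i)
      (\sum_(i <- r) b i * \prod_(j <- r | j != i) l j).
  by apply; exact: index_enum_uniq.
elim=> [_|i r IH /= /andP[ir ur]].
  rewrite !big_nil; under [X in has_slope X]funext do rewrite big_nil.
  exact: has_slope_cst.
rewrite !big_cons; under [X in has_slope X]funext do rewrite big_cons.
apply: has_slope_eq (has_slopeM (H i) (IH ur)) _ _ => //.
rewrite eqxx/= mulr_sumr; congr (_ * _ + _).
  rewrite big_seq [RHS]big_seq_cond; apply: eq_bigl => j; case: eqVneq => [->|].
    by rewrite (negbTE ir).
  by rewrite andbT.
apply: eq_big_seq => j jr; rewrite big_cons mulrCA; congr (_ * _).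
by case: eqVneq => [ij|//]; move: ir; rewrite ij jr.
Qed.

Definition has_slope_mx m n (H : P -> 'M[R]_(m, n)) (L B : 'M[R]_(m, n)) :=
  forall i j, has_slope (fun z => H z i j) (L i j) (B i j).

Lemma has_slope_mx_uniq m n (H K : P -> 'M[R]_(m, n)) L B L' B' :
  (\forall t \near F, H (z1 t) = K (z1 t) /\ H (z0 t) = K (z0 t)) ->
  has_slope_mx H L B -> has_slope_mx K L' B' -> L = L' /\ B = B'.
Proof.
move=> HK hH hK; suff E i j : L i j = L' i j /\ B i j = B' i j.
  by split; apply/matrixP => i j; have [] := E i j.
apply: has_slope_uniq (hH i j) (hK i j).
by apply: filterS HK => t [-> ->].
Qed.

Lemma has_slope_mx_eq m n (H : P -> 'M[R]_(m, n)) L B L' B' :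
  has_slope_mx H L B -> L = L' -> B = B' -> has_slope_mx H L' B'.
Proof. by move=> ? <- <-. Qed.

Lemma has_slope_mx_cst m n (A : 'M[R]_(m, n)) : has_slope_mx (fun=> A) A 0.
Proof. by move=> i j; rewrite mxE; exact: has_slope_cst. Qed.

Lemma has_slope_mxD m n (H K : P -> 'M[R]_(m, n)) L B L' B' :
  has_slope_mx H L B -> has_slope_mx K L' B' ->
  has_slope_mx (fun z => H z + K z) (L + L') (B + B').
Proof.
move=> hH hK i j; rewrite !mxE; under [X in has_slope X]funext do rewrite mxE.
exact: has_slopeD.
Qed.

Lemma has_slope_mxZ m n h (H : P -> 'M[R]_(m, n)) l b L B :
  has_slope h l b -> has_slope_mx H L B ->
  has_slope_mx (fun z => h z *: H z) (l *: L) (b *: L + l *: B).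
Proof.
move=> hh hH i j; rewrite !mxE; under [X in has_slope X]funext do rewrite mxE.
exact: has_slopeM.
Qed.

Lemma has_slope_mxN m n (H : P -> 'M[R]_(m, n)) L B :
  has_slope_mx H L B -> has_slope_mx (fun z => - H z) (- L) (- B).
Proof.
move=> hH i j; rewrite !mxE; under [X in has_slope X]funext do rewrite mxE.
exact: has_slopeN.
Qed.

Lemma has_slope_mxM m n p (H : P -> 'M[R]_(m, n)) (K : P -> 'M[R]_(n, p))
    L B L' B' :
  has_slope_mx H L B -> has_slope_mx K L' B' ->
  has_slope_mx (fun z => H z *m K z) (L *m L') (B *m L' + L *m B').
Proof.
move=> hH hK i j; rewrite !mxE -big_split/=.
under [X in has_slope X]funext do rewrite mxE.
by apply: has_slope_sum => k _; apply: has_slopeM.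
Qed.

Lemma has_slope_mx_tr m n (H : P -> 'M[R]_(m, n)) L B :
  has_slope_mx H L B -> has_slope_mx (fun z => (H z)^T) L^T B^T.
Proof.
by move=> hH i j; rewrite !mxE; under [X in has_slope X]funext do rewrite mxE.
Qed.

Lemma has_slope_mx_linear m n p q (f : {linear 'M[R]_(m, n) -> 'M[R]_(p, q)})
    (H : P -> 'M[R]_(m, n)) L B :
  has_slope_mx H L B -> has_slope_mx (fun z => f (H z)) (f L) (f B).
Proof.
move=> hH i j.
have E A : f A i j = \sum_i' \sum_j' f (delta_mx i' j') i j * A i' j'.
  rewrite {1}(matrix_sum_delta A) linear_sum summxE; apply: eq_bigr => i' _.
  rewrite linear_sum summxE; apply: eq_bigr => j' _.
  by rewrite linearZ mxE mulrC.
rewrite !E; under [X in has_slope X]funext do rewrite E.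
by apply: has_slope_sum => i' _; apply: has_slope_sum => j' _; exact: has_slopeZ.
Qed.

(** Jacobi's formula. The product rule differentiates one row at a time, and Laplace expansion along
    that row turns its contribution into a diagonal entry of [B *m \adj L]. *)
Lemma has_slope_det n (H : P -> 'M[R]_n) L B : has_slope_mx H L B ->
  has_slope (fun z => \det (H z)) (\det L) (\tr (B *m \adj L)).
Proof.
move=> hH; rewrite /determinant.
have hs (s : 'S_n) : has_slope (fun z => (-1) ^+ s * \prod_i H z i (s i))
    ((-1) ^+ s * \prod_i L i (s i))
    ((-1) ^+ s * \sum_i B i (s i) * \prod_(j | j != i) L j (s j)).
  by apply: has_slopeZ; apply: has_slope_prod => i.
apply: has_slope_eq (has_slope_sum _ (fun s _ => hs s)) _ _ => //.
rewrite /mxtrace; under eq_bigr do rewrite mulr_sumr.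
rewrite exchange_big/=; apply: eq_bigr => i _.
pose Li := \matrix_(i', j') if i' == i then B i j' else L i' j'.
transitivity (\det Li).
  apply: eq_bigr => s _; congr (_ * _).
  rewrite [RHS](bigD1 i)//= mxE eqxx; congr (_ * _).
  by apply: eq_bigr => j /negbTE ji; rewrite mxE ji.
rewrite (expand_det_row _ i) mxE; apply: eq_bigr => j _.
rewrite !mxE eqxx; congr (_ * _); rewrite /cofactor; congr (_ * \det _).
by apply/matrixP => k l; rewrite !mxE eq_sym (negbTE (neq_lift _ _)).
Qed.

(** Existence suffices: the derivative of the velocity built on it is later pinned down by the
    linearized Legendre relation. *)
Lemma has_slope_mx_adj n (H : P -> 'M[R]_n) L B : has_slope_mx H L B ->
  exists B', has_slope_mx (fun z => \adj (H z)) (\adj L) B'.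
Proof.
move=> hH.
exists (\matrix_(i, j) ((-1) ^+ (j + i) *
  \tr (row' j (col' i B) *m \adj (row' j (col' i L))))) => i j.
rewrite !mxE; under [X in has_slope X]funext do rewrite mxE.
apply: has_slopeZ; apply: has_slope_det => k l.
by rewrite !mxE; under [X in has_slope X]funext do rewrite !mxE; exact: hH.
Qed.

End Slopes.

(** * Top powers of a two-form *)

Section AlternatingForms.
Variables (R : realType) (V : lmodType R).

Definition set_slot N (v : 'I_N -> V) (i : 'I_N) (x : V) : 'I_N -> V :=
  fun j => if j == i then x else v j.

Definition multilinear N (F : form R V N) := forall v i a x y,
  F (set_slot v i (a *: x + y)) = a * F (set_slot v i x) + F (set_slot v i y).

Definition alternating N (F : form R V N) := forall v (s : 'S_N),
  F (fun i => v (s i)) = (-1) ^+ s * F v.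

Lemma wedge_form_alternating k l (a : form R V k) (b : form R V l) :
  alternating (wedge_form a b).
Proof.
move=> v t; rewrite /wedge_form mulrCA; congr (_ * _).
rewrite (reindex_inj (mulIg t^-1%g))/= mulr_sumr; apply: eq_bigr => s _.
rewrite odd_permM odd_permV signr_addb mulrA mulrA [in RHS]mulrC.
rewrite [RHS]mulrC -!mulrA mulrCA; congr (_ * (_ * _)).
by congr (a _ * b _); apply/funext => i; rewrite !permM permKV.
Qed.

(** Under each permutation the slot [i] feeds exactly one of the factors [a] and [b], and the
    linearity of that factor applies. *)
Lemma wedge_form_multilinear k l (a : form R V k) (b : form R V l) :
  multilinear a -> multilinear b -> multilinear (wedge_form a b).
Proof.
move=> al bl v i c x y; rewrite /wedge_form mulrCA -mulrDr; congr (_ * _).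
rewrite mulr_sumr -big_split; apply: eq_bigr => s _ /=.
rewrite (mulrCA c) -mulrDr; congr (_ * _).
rewrite -[i](permKV s); case: (split_ordP ((s^-1)%g i)) => [i' ->|i' ->].
- have Ea z : (fun j => set_slot v (s (lshift l i')) z (s (lshift l j))) =
              set_slot (fun j => v (s (lshift l j))) i' z.
    by apply/funext => j; rewrite /set_slot (inj_eq perm_inj) (inj_eq (@lshift_inj _ _)).
  have Eb z : (fun j => set_slot v (s (lshift l i')) z (s (rshift k j))) =
              (fun j => v (s (rshift k j))).
    by apply/funext => j; rewrite /set_slot (inj_eq perm_inj) eq_rlshift.
  by rewrite !Ea !Eb al mulrDl mulrA.
- have Ea z : (fun j => set_slot v (s (rshift k i')) z (s (rshift k j))) =
              set_slot (fun j => v (s (rshift k j))) i' z.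
    by apply/funext => j; rewrite /set_slot (inj_eq perm_inj) (inj_eq (@rshift_inj _ _)).
  have Eb z : (fun j => set_slot v (s (rshift k i')) z (s (lshift l j))) =
              (fun j => v (s (lshift l j))).
    by apply/funext => j; rewrite /set_slot (inj_eq perm_inj) eq_lrshift.
  by rewrite !Ea !Eb bl mulrDr mulrCA.
Qed.

Lemma wedge_power_alternating k (a : form R V k) m :
  alternating (wedge_power a m).
Proof.
case: m => [|m]; last exact: wedge_form_alternating.
move=> v s; rewrite /= (_ : s = 1%g) ?odd_perm1 ?mulr1//.
by apply/permP => -[].
Qed.

Lemma wedge_power_multilinear k (a : form R V k) m : multilinear a ->
  multilinear (wedge_power a m).
Proof.
move=> al; elim: m => [|m IH]; first by move=> v [].
exact: wedge_form_multilinear.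
Qed.

(** The power only evaluates [a] on families drawn from its arguments, so frame coordinates can
    replace vectors without a linear map from [V] to [U]. *)
Lemma wedge_power_pullback (U : Type) k (a : form R V k) (b : form R U k) m
    (v : 'I_(m * k) -> V) (u : 'I_(m * k) -> U) :
  (forall f : 'I_k -> 'I_(m * k), a (v \o f) = b (u \o f)) ->
  wedge_power a m v = wedge_power b m u.
Proof.
elim: m v u => [//|m IH] v u ab /=; rewrite /wedge_form; congr (_ * _).
apply: eq_bigr => s _; congr (_ * (_ * _)); first exact: ab.
by apply: IH => f; apply: ab.
Qed.

End AlternatingForms.

(** * Alternating multilinear forms of top degree are multiples of the determinant *)

Section DeterminantUniqueness.
Variable R : realType.

(** Splits a function into its value at [a] and the rest; the functions with value [j0] at [a] serve
    as names for the rest. *)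
Lemma sum_ffun_slot (I J : finType) (Phi : {ffun I -> J} -> R) (a : I) (j0 : J) :
  \sum_f Phi f = \sum_(f : {ffun I -> J} | f a == j0)
    \sum_j Phi [ffun i => if i == a then j else f i].
Proof.
rewrite (partition_big (fun f : {ffun I -> J} =>
    [ffun i => if i == a then j0 else f i]) (fun f => f a == j0))/=; last first.
  by move=> f _; rewrite ffunE eqxx.
apply: eq_bigr => f /eqP fa.
rewrite (reindex_onto (fun j => [ffun i => if i == a then j else f i])
  (fun g : {ffun I -> J} => g a))/=.
  apply: eq_bigl => j; rewrite ffunE !eqxx andbT; apply/eqP/ffunP => i.
  by rewrite !ffunE; case: eqVneq => [->|].
move=> g /eqP /ffunP gf; apply/ffunP => i; rewrite ffunE.
by case: eqVneq => [->//|ia]; rewrite -gf ffunE (negbTE ia).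
Qed.

Lemma multilinear_sum_delta N k (F : form R 'rV[R]_k N) (v : 'I_N -> 'rV[R]_k)
    (i : 'I_N) : multilinear F ->
  F v = \sum_j v i 0 j * F (set_slot v i (delta_mx 0 j)).
Proof.
move=> Fl.
have F0 : F (set_slot v i 0) = 0.
  by have := Fl v i (-1) 0 0; rewrite scaler0 addr0 mulN1r addNr.
have -> : F v = F (set_slot v i (\sum_j v i 0 j *: delta_mx 0 j)).
  rewrite -row_sum_delta; congr (F _).
  by apply/funext => j; rewrite /set_slot; case: eqVneq => [->|].
elim: (index_enum _) => [|j s IH]; first by rewrite !big_nil.
by rewrite !big_cons Fl IH.
Qed.

Lemma multilinear_expand N k (F : form R 'rV[R]_k.+1 N)
    (v : 'I_N -> 'rV[R]_k.+1) : multilinear F ->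
  F v = \sum_(f : {ffun 'I_N -> 'I_k.+1})
    (\prod_i v i 0 (f i)) * F (fun i => delta_mx 0 (f i)).
Proof.
move=> Fl.
(* In [S r] the slots of [r] are already expanded. Outside [r] the indicator pins [f i] to the dummy
   value 0, so the sum ranges over all functions throughout, and induction on [r] expands one slot
   at a time. *)
pose S (r : seq 'I_N) := \sum_(f : {ffun 'I_N -> 'I_k.+1})
  (\prod_i (if i \in r then v i 0 (f i) else (f i == 0)%:R)) *
  F (fun i => if i \in r then delta_mx 0 (f i) else v i).
transitivity (S [::]).
  rewrite /S (bigD1 [ffun=> 0])//= [X in _ + X]big1 ?addr0.
    by rewrite big1 ?mul1r// => i _; rewrite ffunE eqxx.
  move=> f /eqP f0; have [i fi] : exists i, f i != 0.
    apply: contrapT => /forallNP H; apply: f0; apply/ffunP => i; rewrite ffunE.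
    by have /negP := H i; rewrite negbK => /eqP.
  by rewrite (bigD1 i)//= (negbTE fi) !mul0r.
transitivity (S (enum 'I_N)); last first.
  apply: eq_bigr => f _; congr (_ * F _).
    by apply: eq_bigr => i _; rewrite mem_enum.
  by apply/funext => i; rewrite mem_enum.
elim: (enum 'I_N) => [//|a r ->].
have [ar|ar] := boolP (a \in r).
  have E i : (i \in a :: r) = (i \in r).
    by rewrite inE; case: eqVneq => // ->.
  apply: eq_bigr => f _; congr (_ * F _).
    by apply: eq_bigr => i _; rewrite E.
  by apply/funext => i; rewrite E.
rewrite /S (sum_ffun_slot _ a 0) [RHS](sum_ffun_slot _ a 0).
apply: eq_bigr => f _.
pose w i := if i \in r then delta_mx 0 (f i) else v i.
pose c := \prod_(i | i != a) (if i \in r then v i 0 (f i) else (f i == 0)%:R).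
transitivity (c * F w).
  rewrite (bigD1 0)//= [X in _ + X]big1 ?addr0.
    rewrite (bigD1 a)//= (negbTE ar) ffunE !eqxx mul1r; congr (_ * F _).
      by apply: eq_bigr => i /negbTE ia; rewrite ffunE ia.
    apply/funext => i; rewrite /w; case: ifP => // ir; rewrite ffunE.
    by case: eqVneq ir => // ->; rewrite (negbTE ar).
  by move=> j j0; rewrite (bigD1 a)//= (negbTE ar) ffunE eqxx (negbTE j0) !mul0r.
rewrite (multilinear_sum_delta w a Fl) mulr_sumr; apply: eq_bigr => j _.
rewrite mulrA [c * _]mulrC; congr (_ * F _).
  rewrite [RHS](bigD1 a)//= mem_head ffunE eqxx {1}/w (negbTE ar); congr (_ * _).
  by apply: eq_bigr => i ia; rewrite inE (negbTE ia)/= ffunE (negbTE ia).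
apply/funext => i; rewrite /set_slot /w inE ffunE.
by case: eqVneq.
Qed.

(** In the expansion over basis vectors, a non-injective index map repeats an argument and is killed
    by the transposition of the two slots; an injective one is a permutation and gives a term of the
    Leibniz formula. *)
Lemma alternating_eq_det N (F : form R 'rV[R]_N N) (v : 'I_N -> 'rV[R]_N) :
  multilinear F -> alternating F ->
  F v = \det (\matrix_i v i) * F (fun i => delta_mx 0 i).
Proof.
case: N F v => [|N] F v Fl Fa.
  by rewrite det_mx00 mul1r; congr (F _); apply/funext => -[].
rewrite (multilinear_expand v Fl).
rewrite (bigID (fun f : {ffun _ -> _} => injectiveb f))/= addrC big1 ?add0r.
  rewrite (reindex (@pval _)) /=; last first.
    pose in_Sn := insubd (1%g : 'S_N.+1).
    by exists in_Sn => /= f Uf; first apply: val_inj; exact: insubdK.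
  rewrite /determinant mulr_suml; apply: eq_big => [s|s _].
    by rewrite pvalE; apply/injectiveP; exact: perm_inj.
  rewrite pvalE -mulrA mulrCA Fa; congr (_ * _).
  by apply: eq_bigr => i _; rewrite !mxE.
move=> f /injectivePn[i1 [i2 i12 fi]].
suff -> : F (fun i => delta_mx 0 (f i)) = 0 by rewrite mulr0.
have := Fa (fun i => delta_mx 0 (f i)) (tperm i1 i2).
rewrite odd_tperm i12 mulN1r => H.
apply/eqP; rewrite -eqNr -H; apply/eqP; congr (F _); apply/funext => i.
by case: tpermP => [->|->|]//; rewrite fi.
Qed.

End DeterminantUniqueness.

Section SymplecticForm.
Variable R : realType.

Lemma dotvE n (x y : 'cV[R]_n) : dotv x y = \sum_i x i 0 * y i 0.
Proof. by rewrite /dotv mxE; apply: eq_bigr => i _; rewrite mxE. Qed.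

Lemma symplectic_formE n (v : 'I_2 -> 'cV[R]_n * 'cV[R]_n) :
  symplectic_form v = dotv (v 0).1 (v 1).2 - dotv (v 1).1 (v 0).2.
Proof.
rewrite !dotvE -sumrB; apply: eq_bigr => i _; rewrite /wedge_form.
have -> : 1`! = 1%N by [].
rewrite mulr1 invr1 mul1r.
have -> (f : 'S_2 -> R) : \sum_s f s = f 1%g + f (tperm 0 1).
  rewrite (bigD1 1%g)//= (bigD1 (tperm 0 1))/=; last first.
    by apply/eqP => /permP /(_ 0); rewrite tpermL perm1.
  rewrite big1 ?addr0// => s /andP[s1 st]; exfalso.
  case: (s 0 =P 0) => [s0|/eqP s0].
    move/eqP: s1; apply; apply/permP => j; rewrite perm1.
    have [->//|j0] := eqVneq j 0.
    have : s j != 0 by rewrite -s0 (inj_eq perm_inj).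
    by move: j0; case: j (s j) => -[|[|//]] ? [[|[|//]] ?]// _ _; apply: val_inj.
  move/eqP: st; apply; apply/permP => j.
  have s01 : s 0 = 1 by move: s0; case: (s 0) => -[|[|//]] ?// _; apply: val_inj.
  have [->|j0] := eqVneq j 0; first by rewrite tpermL.
  have -> : j = 1 by move: j0; case: j => -[|[|//]] ?// _; apply: val_inj.
  rewrite tpermR.
  have : s 1 != 1 by rewrite -s01 (inj_eq perm_inj).
  by case: (s 1) => -[|[|//]] ?// _; apply: val_inj.
rewrite odd_perm1 odd_tperm/= mul1r mulN1r /dp /dgamma.
have -> : lshift 1 (0 : 'I_1) = 0 :> 'I_2 by apply: val_inj.
have -> : rshift 1 (0 : 'I_1) = 1 :> 'I_2 by apply: val_inj.
by rewrite !perm1 tpermL tpermR.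
Qed.

Definition std_symplectic k : form R 'rV[R]_(k + k) 2 := fun c =>
  \sum_(i < k) (c 0 0 (lshift k i) * c 1 0 (rshift k i)
                - c 1 0 (lshift k i) * c 0 0 (rshift k i)).

Lemma std_symplectic_multilinear k : multilinear (@std_symplectic k).
Proof.
move=> v i a x y; rewrite /std_symplectic mulr_sumr -big_split/=.
apply: eq_bigr => j _; rewrite /set_slot.
case: i => -[|[|//]] ? /=; rewrite !mxE; ring.
Qed.

End SymplecticForm.

(** * Frames and the inertia operator *)

Section Vectors.
Variables (R : realType) (n : nat).
Implicit Types (x y z : 'cV[R]_n) (A B : 'M[R]_n).

Lemma mx11_dotv x y : x^T *m y = (dotv x y)%:M.
Proof. exact: mx11_scalar. Qed.

Lemma dotvC x y : dotv x y = dotv y x.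
Proof. by rewrite /dotv -[y in LHS]trmxK -trmx_mul mxE. Qed.

Lemma dotv0r x : dotv x 0 = 0. Proof. by rewrite /dotv mulmx0 mxE. Qed.

Lemma dotvDr x y z : dotv x (y + z) = dotv x y + dotv x z.
Proof. by rewrite /dotv mulmxDr mxE. Qed.

Lemma dotvDl x y z : dotv (y + z) x = dotv y x + dotv z x.
Proof. by rewrite !(dotvC _ x) dotvDr. Qed.

Lemma dotvZr x a y : dotv x (a *: y) = a * dotv x y.
Proof. by rewrite /dotv -scalemxAr mxE. Qed.

Lemma dotvZl x a y : dotv (a *: y) x = a * dotv y x.
Proof. by rewrite !(dotvC _ x) dotvZr. Qed.

Lemma dotvNr x y : dotv x (- y) = - dotv x y.
Proof. by rewrite -scaleN1r dotvZr mulN1r. Qed.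

Lemma dotvNl x y : dotv (- y) x = - dotv y x.
Proof. by rewrite !(dotvC _ x) dotvNr. Qed.

Lemma dotv_mulmx m x (C : 'M[R]_(n, m)) (y : 'cV[R]_m) :
  dotv x (C *m y) = dotv (C^T *m x) y.
Proof. by rewrite /dotv trmx_mul trmxK mulmxA. Qed.

Lemma dotv_ge0 x : 0 <= dotv x x.
Proof. by rewrite dotvE sumr_ge0// => i _; rewrite -expr2 sqr_ge0. Qed.

Lemma dotv_eq0 x : (dotv x x == 0) = (x == 0).
Proof.
apply/eqP/eqP => [|->]; last exact: dotv0r.
rewrite dotvE => /psumr_eq0P H; apply/matrixP => i j.
have /eqP := H (fun i _ => sqr_ge0 (x i 0)) i isT.
by rewrite mulf_eq0 orbb ord1 mxE => /eqP.
Qed.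

Lemma mulmx_tens x y z : x *m y^T *m z = dotv y z *: x.
Proof. by rewrite -mulmxA mx11_dotv mul_mx_scalar. Qed.

Lemma wedgev_mul x y z : wedgev x y *m z = dotv y z *: x - dotv x z *: y.
Proof. by rewrite /wedgev /tensv mulmxBl !mulmx_tens. Qed.

Lemma wedgev_so x y : so (wedgev x y).
Proof.
rewrite /so/= /wedgev /tensv linearB/= !trmx_mul !trmxK.
by rewrite opprB.
Qed.

Lemma wedgevN x y : wedgev x y = - wedgev y x.
Proof. by rewrite /wedgev opprB. Qed.

Lemma wedgevv x : wedgev x x = 0.
Proof. by rewrite /wedgev subrr. Qed.

Lemma wedgevDl x y z : wedgev (x + y) z = wedgev x z + wedgev y z.
Proof. by rewrite -[LHS]/(wedge_with z (x + y)) linearD. Qed.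

Lemma wedgevZl a x z : wedgev (a *: x) z = a *: wedgev x z.
Proof. by rewrite -[LHS]/(wedge_with z (a *: x)) linearZ. Qed.

Lemma wedgevDr x y z : wedgev z (x + y) = wedgev z x + wedgev z y.
Proof. by rewrite !(wedgevN z) wedgevDl opprD. Qed.

Lemma wedgevZr a x z : wedgev z (a *: x) = a *: wedgev z x.
Proof. by rewrite !(wedgevN z) wedgevZl scalerN. Qed.

Lemma dotv_so A x y : so A -> dotv x (A *m y) = - dotv y (A *m x).
Proof. by move=> sA; rewrite dotv_mulmx sA mulNmx dotvNl dotvC. Qed.

Lemma so_dotC A B : so_dot A B = so_dot B A.
Proof. by rewrite /so_dot mxtrace_mulC. Qed.

Lemma so_dot_wedgev A x y : so A -> so_dot A (wedgev x y) = - dotv y (A *m x).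
Proof.
move=> sA; rewrite /so_dot /wedgev /tensv mulmxBr raddfB/= !mulmxA.
rewrite mxtrace_mulC [in X in _ - X]mxtrace_mulC.
rewrite !trace_mx11 -/(dotv y (A *m x)) -/(dotv x (A *m y)).
by rewrite (dotv_so x y sA) opprK; field.
Qed.

Lemma trmx_mul_eq0 A : so A -> (forall B, B^T = B -> \tr (A *m B) = 0).
Proof.
move=> sA B sB; have : \tr (A *m B) = - \tr (A *m B).
  by rewrite -{1}mxtrace_tr trmx_mul sA sB mulmxN mxtrace_mulC linearN.
by move/eqP; rewrite eq_sym eqNr => /eqP.
Qed.

End Vectors.

(** * Positive definite matrices and determinants on subspaces *)

Section Matrices.
Variable R : realType.

Definition fun_mx m n (f : 'cV[R]_n -> 'cV[R]_m) : 'M[R]_(m, n) :=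
  \matrix_(i, j) f (delta_mx j 0) i 0.

Lemma fun_mxE m n (f : 'cV[R]_n -> 'cV[R]_m) h : linear f -> f h = fun_mx f *m h.
Proof.
move=> fl; pose g := GRing.isLinear.Build _ _ _ _ f fl.
pose F : {linear _ -> _} := HB.pack f g.
suff : F h = fun_mx F *m h by [].
rewrite {1}(matrix_sum_delta h) linear_sum.
apply/matrixP => i j; rewrite (ord1 j) summxE mxE; apply: eq_bigr => k _.
by rewrite big_ord1 linearZ !mxE mulrC.
Qed.

(** Deformation to the identity: were the determinant not positive, (1 - s) 1 + s B would be
    singular for some s in [0, 1], yet all these matrices are positive definite. *)
Lemma det_posdef_gt0 k (B : 'M[R]_k) :
  (forall h, h != 0 -> 0 < dotv h (B *m h)) -> 0 < \det B.
Proof.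
move=> Bpos; pose p : {poly R} :=
  - \det ((1 - 'X)%:M + 'X *: map_mx polyC B).
have pE s : p.[s] = - \det ((1 - s)%:M + s *: B).
  rewrite /p hornerN -horner_evalE -det_map_mx; congr (- \det _).
  apply/matrixP => i j; rewrite !mxE /= /horner_eval.
  by rewrite hornerD hornerM hornerX hornerC hornerMn hornerD hornerN hornerC hornerX.
rewrite ltNge; apply/negP => B0.
(* [poly_ivt] wants a non-positive value at 0 and a non-negative one at 1, whence the sign in
   [p]. *)
have [||s /andP[s0 s1] /rootP] := @poly_ivt _ p 0 1.
- exact: ler01.
- rewrite !pE subrr subr0 scale0r addr0 scale1r det1.
  by rewrite raddf0 add0r oppr_ge0 B0 lerN10.
rewrite pE => /eqP; rewrite oppr_eq0 -det_tr => /eqP /eqP /det0P[r r0 rE].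
pose h := r^T; have h0 : h != 0 by rewrite -(trmx0 R) (inj_eq trmx_inj).
have : dotv h (((1 - s)%:M + s *: B) *m h) = 0.
  rewrite (_ : _ *m _ = 0) ?dotv0r//.
  by rewrite -[LHS]trmxK trmx_mul trmxK rE trmx0.
rewrite mulmxDl mul_scalar_mx -scalemxAl dotvDr !dotvZr.
have := Bpos h h0; have : 0 < dotv h h by rewrite lt0r dotv_ge0 dotv_eq0 h0.
move=> a b; have [->|sn0] := eqVneq s 0.
  by rewrite subr0 mul0r mul1r addr0 => a0; rewrite a0 ltxx in a.
have spos : 0 < s by rewrite lt0r sn0.
move=> E; have : 0 < (1 - s) * dotv h h + s * dotv h (B *m h).
  by rewrite ltr_wpDl ?mulr_ge0 ?mulr_gt0 ?subr_ge0// ltW.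
by rewrite E ltxx.
Qed.

(** The rank forces d = k. The sizes are kept distinct because the dimension of a subspace is not
    syntactically the number of its frame vectors. *)
Lemma det_conj_mx d k (P : 'M[R]_(d, k)) (Q : 'M[R]_(k, d)) (B : 'M[R]_k) :
  P *m Q = 1%:M -> Q *m P = 1%:M -> \det (P *m B *m Q) = \det B.
Proof.
move=> PQ QP; have dk : d = k.
  apply/eqP; rewrite eqn_leq.
  have le_dk a b (X : 'M[R]_(a, b)) Y : X *m Y = 1%:M -> (a <= b)%N.
    by move=> XY; rewrite -(mxrank1 R a) -XY (leq_trans (mulmx_max_rank _ _)).
  by rewrite (le_dk _ _ _ _ PQ) (le_dk _ _ _ _ QP).
subst d; rewrite !det_mulmx mulrAC -det_mulmx PQ det1 mul1r//.
Qed.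

(** Change of basis between [vbasis U] and [b], with [beta] as functionals dual to [b]; [P] and [Q]
    are the two transition matrices. *)
Lemma det_on_basis (vT : vectType R) (U : {vspace vT}) (f : vT -> vT) k
    (b : 'I_k -> vT) (beta : 'I_k -> {linear vT -> R^o}) (B : 'M[R]_k) :
  (forall i, b i \in U) ->
  (forall u, u \in U -> u = \sum_i beta i u *: b i) ->
  (forall i j, beta i (b j) = (i == j)%:R) ->
  (forall c : 'I_k -> R, f (\sum_j c j *: b j) =
     \sum_j c j *: \sum_i B i j *: b i) ->
  det_on U f = \det B.
Proof.
move=> bU Ub bb fb; rewrite /det_on -det_tr.
set X := vbasis U; have Xb : basis_of U X := vbasisP U.
have Xfree := basis_free Xb.
have XU i : X`_i \in U.
  have [iU|iU] := ltnP i (\dim U); last by rewrite nth_default ?mem0v// size_tuple.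
  by apply: (basis_mem Xb); rewrite mem_nth// size_tuple.
pose P := \matrix_(a < \dim U, i < k) (beta i X`_a : R).
pose Q := \matrix_(i < k, a < \dim U) coord X a (b i).
have bX i : b i = \sum_a Q i a *: X`_a.
  rewrite {1}(coord_basis Xb (bU i)); apply: eq_bigr => a _.
  by rewrite mxE.
have PQ : P *m Q = 1%:M.
  apply/matrixP => a c; rewrite !mxE -(coord_free a c Xfree).
  rewrite {1}(Ub _ (XU a)) linear_sum.
  by apply: eq_bigr => i _; rewrite linearZ !mxE.
have QP : Q *m P = 1%:M.
  apply/matrixP => i j; rewrite !mxE eq_sym -bb {1}(bX i) linear_sum.
  by apply: eq_bigr => a _; rewrite linearZ !mxE.
rewrite -(det_tr B) -(det_conj_mx B^T PQ QP) -[RHS]det_tr; congr (\det _).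
apply/matrixP => a c; rewrite !mxE (Ub _ (XU c)) fb linear_sum.
rewrite (eq_bigr (fun i => P c i * \sum_j B j i * Q j a)); last first.
  move=> i _; rewrite linearZ/= linear_sum mxE; congr (_ * _).
  by apply: eq_bigr => j _; rewrite linearZ !mxE.
rewrite (eq_bigr (fun i => \sum_j P c i * (B j i * Q j a))); last first.
  by move=> i _; rewrite mulr_sumr.
rewrite exchange_big; apply: eq_bigr => j _.
rewrite [in RHS]mxE mulr_suml; apply: eq_bigr => i _.
by rewrite [B^T _ _]mxE mulrA.
Qed.

End Matrices.

(** * Orthonormal frames of the tangent spaces of the sphere *)

Section Frames.
Variables (R : realType) (k : nat).
Implicit Types (E : 'M[R]_(k.+1, k)) (g : 'cV[R]_k.+1).

Definition is_frame E g := E^T *m E = 1%:M /\ E^T *m g = 0.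

Lemma frame_complete E g : dotv g g = 1 -> is_frame E g ->
  E *m E^T + g *m g^T = 1%:M.
Proof.
move=> gg [EE Eg]; pose O : 'M[R]_(1 + k) := row_mx g E.
have : O^T *m O = 1%:M.
  rewrite tr_row_mx mul_col_row mx11_dotv gg EE Eg.
  by rewrite -[g^T *m E]trmxK trmx_mul trmxK Eg trmx0 -scalar_mx_block.
by move/mulmx1C; rewrite tr_row_mx mul_row_col addrC.
Qed.

Lemma frame_decomp E g x : dotv g g = 1 -> is_frame E g ->
  x = E *m (E^T *m x) + dotv g x *: g.
Proof.
move=> gg Eg; rewrite -[LHS]mul1mx -(frame_complete gg Eg) mulmxDl.
by rewrite mulmx_tens mulmxA.
Qed.

(* On the orthogonal complement of g0 this is the rotation that takes g0 to g and
   fixes the vectors orthogonal to both. *)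
Definition transport E g0 g :=
  E - (1 + dotv g0 g)^-1 *: ((g + g0) *m (g^T *m E)).

(** The identity |g + g0|^2 = 2 (1 + (g0, g)) makes the quadratic correction cancel the two linear
    ones. *)
Lemma transport_frame E g0 g : dotv g0 g0 = 1 -> dotv g g = 1 ->
  1 + dotv g0 g != 0 -> is_frame E g0 -> is_frame (transport E g0 g) g.
Proof.
move=> g00 gg ne [EE Eg0]; set c := 1 + dotv g0 g in ne *.
set w := g^T *m E.
have wT : E^T *m g = w^T by rewrite trmx_mul trmxK.
have tT : (transport E g0 g)^T = E^T - c^-1 *: (w^T *m (g + g0)^T).
  by rewrite /transport linearB linearZ/= -/c trmx_mul.
have EgT : E^T *m (g + g0) = w^T by rewrite mulmxDr Eg0 addr0.
have gET : (g + g0)^T *m E = w.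
  by rewrite -[LHS]trmxK trmx_mul trmxK EgT trmxK.
have sg : (g + g0)^T *m g = c%:M.
  by rewrite mx11_dotv dotvDl gg.
have ss : (g + g0)^T *m (g + g0) = (2 * c)%:M.
  rewrite mx11_dotv dotvDl !dotvDr gg g00 (dotvC g g0) /c.
  by congr (_%:M); ring.
split; rewrite tT.
  rewrite mulmxBl /transport -/c !mulmxBr EE -/w.
  rewrite -!scalemxAl -!scalemxAr -!mulmxA gET.
  rewrite (mulmxA E^T) EgT (mulmxA (g + g0)^T) ss mul_scalar_mx -!scalemxAr.
  rewrite !scalerA -addrA -[RHS]addr0; congr (_ + _).
  rewrite (_ : c^-1 * (c^-1 * (2 * c)) = c^-1 + c^-1); last by field.
  by rewrite scalerDl opprB addrK addNr.
rewrite mulmxBl -scalemxAl -mulmxA sg mul_mx_scalar scalerA mulVf// scale1r.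
by rewrite wT subrr.
Qed.

(** The standard frame at a coordinate vector [e] is transported to [g]; if [g] is antipodal to [e],
    the start is [- e], which has the same frame [E0]. *)
Lemma exists_frame g : dotv g g = 1 -> exists E, is_frame E g.
Proof.
move=> gg; pose e : 'cV[R]_(1 + k) := col_mx 1%:M 0.
pose E0 : 'M[R]_(1 + k, k) := col_mx 0 1%:M.
have E0T : E0^T = row_mx 0 1%:M by rewrite /E0 tr_col_mx trmx1 trmx0.
have E0E0 : E0^T *m E0 = 1%:M.
  by rewrite E0T /E0 mul_row_col mul0mx add0r mul1mx.
have E0e : E0^T *m e = 0.
  by rewrite E0T /e mul_row_col mul0mx mulmx0 addr0.
have frame_e a : a * a = 1 -> dotv (a *: e) (a *: e) = 1 /\ is_frame E0 (a *: e).
  move=> aa; split.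
    rewrite dotvZl dotvZr mulrA aa mul1r /dotv tr_col_mx mul_row_col trmx1.
    by rewrite trmx0 mul0mx addr0 mul1mx mxE.
  by split=> //; rewrite -scalemxAr E0e scaler0.
suff [a [aa ne]] : exists a : R, a * a = 1 /\ 1 + dotv (a *: e) g != 0.
  have [ee fe] := frame_e a aa.
  by exists (transport E0 (a *: e) g); apply: transport_frame.
have [e0|ne] := eqVneq (1 + dotv e g) 0; last first.
  by exists 1; rewrite mulr1 scale1r.
exists (-1); split; first by rewrite mulrNN mulr1.
rewrite dotvZl mulN1r (_ : dotv e g = -1); last first.
  by apply/eqP; rewrite -addr_eq0 addrC e0.
by rewrite opprK (_ : 1 + 1 = 2)// pnatr_eq0.
Qed.

End Frames.

(** * The inertia operator and the inverse Legendre transformation *)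

Section InertiaOperator.
Variables (R : realType) (n : nat) (I : {linear 'M[R]_n -> 'M[R]_n}).
Hypothesis HI : inertia_operator I.
Implicit Types (a b x y z g : 'cV[R]_n).

(** Turning the dependence on [y] into a matrix brings the inertia terms under matrix algebra:
    products, transposes, traces. For a = b it is, up to sign, the quadratic form of I on the wedges
    with [a]. *)
Definition theta a b : 'M[R]_n := fun_mx (fun y => I (wedgev a y) *m b).

Lemma thetaE a b y : I (wedgev a y) *m b = theta a b *m y.
Proof.
rewrite /theta -(@fun_mxE _ _ _ (fun y => I (wedgev a y) *m b))// => c u v.
by rewrite wedgevDr wedgevZr linearP mulmxDl scalemxAl.
Qed.

Lemma thetaNE a b y : I (wedgev y a) *m b = - (theta a b *m y).
Proof. by rewrite wedgevN linearN mulNmx thetaE. Qed.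

Lemma inertia_so a b : so (I (wedgev a b)).
Proof. by case: HI => H _ _; exact: H (wedgev_so a b). Qed.

(** Up to the same sign, the two sides pair I(a /\ y) with b /\ z and I(b /\ z) with a /\ y; I is
    self-adjoint. *)
Lemma dotv_theta a b y z : dotv z (theta a b *m y) = dotv y (theta b a *m z).
Proof.
rewrite -!thetaE; apply: oppr_inj.
rewrite -(so_dot_wedgev b z (inertia_so a y)) -(so_dot_wedgev a y (inertia_so b z)).
case: HI => _ H _; rewrite H; [exact: so_dotC|exact: wedgev_so|exact: wedgev_so].
Qed.

Lemma theta_tr a b : (theta a b)^T = theta b a.
Proof.
have E (A : 'M[R]_n) i j : A i j = dotv (delta_mx i 0) (A *m delta_mx j 0).
  rewrite /dotv trmx_delta -rowE -colE !mxE//.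
apply/matrixP => i j; rewrite mxE E dotv_theta -E//.
Qed.

Lemma theta_mul_same a b : theta a b *m a = 0.
Proof. by rewrite -thetaE wedgevv linear0 mul0mx. Qed.

Lemma theta_neg g y : wedgev g y != 0 -> dotv y (theta g g *m y) < 0.
Proof.
move=> w0; rewrite -thetaE -oppr_gt0 -so_dot_wedgev; last exact: inertia_so.
by case: HI => _ _; apply => //; exact: wedgev_so.
Qed.

Lemma legendreE eps g x :
  legendre I eps g x = - (eps ^+ 2)^-1 *: (theta g g *m x).
Proof. by rewrite /legendre thetaE. Qed.

(* Extends the Legendre transformation at g from the tangent space at g to the
   whole ambient space, by the identity on the normal line. *)
Definition legendre_mx eps g : 'M[R]_n :=
  g *m g^T - (eps ^+ 2)^-1 *: theta g g.

Lemma legendre_mxE eps g x :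
  legendre_mx eps g *m x = dotv g x *: g + legendre I eps g x.
Proof. by rewrite legendreE mulmxBl mulmx_tens -scalemxAl scaleNr. Qed.

(** The quadratic form is (g, y)^2 plus a positive multiple of the inertia of g /\ y. The second
    term is positive unless y is parallel to g, and then the first one is. *)
Lemma det_legendre_mx_gt0 eps g : eps != 0 -> dotv g g = 1 ->
  0 < \det (legendre_mx eps g).
Proof.
move=> e0 gg; apply: det_posdef_gt0 => y y0.
rewrite legendre_mxE legendreE dotvDr !dotvZr mulNr (dotvC y g).
have e2 : 0 < (eps ^+ 2)^-1 by rewrite invr_gt0 exprn_even_gt0.
have [w0|w0] := eqVneq (wedgev g y) 0.
  rewrite -thetaE w0 linear0 mul0mx dotv0r mulr0 subr0 -expr2.
  rewrite exprn_even_gt0//=; apply: contra_neq y0 => gy.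
  have : wedgev g y *m g = - y by rewrite wedgev_mul gg (dotvC y) gy scale0r scale1r sub0r.
  by rewrite w0 mul0mx => /eqP; rewrite eq_sym oppr_eq0 => /eqP.
rewrite ltr_wpDl -?expr2 ?sqr_ge0// oppr_gt0 pmulr_rlt0//.
exact: theta_neg.
Qed.

Lemma legendre_tangent eps g x : dotv g (legendre I eps g x) = 0.
Proof.
by rewrite legendreE dotvZr dotv_theta theta_mul_same dotv0r mulr0.
Qed.

(** Cramer's rule for [legendre_mx]: a rational expression, to which the slope rules apply. *)
Definition adj_velocity eps p g : 'cV[R]_n :=
  (\det (legendre_mx eps g))^-1 *: (\adj (legendre_mx eps g) *m p).

Lemma X_gammaP eps p g : eps != 0 -> dotv g g = 1 -> dotv g p = 0 ->
  [/\ dotv g (X_gamma I eps p g) = 0,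
      p = legendre I eps g (X_gamma I eps p g)
    & X_gamma I eps p g = adj_velocity eps p g].
Proof.
move=> e0 gg gp; have /lt0r_neq0 d0 := det_legendre_mx_gt0 e0 gg.
set M := legendre_mx eps g in d0 *; set x := X_gamma I eps p g.
have inj y z : M *m y = M *m z -> y = z.
  move=> /(congr1 (mulmx (\adj M))); rewrite !mulmxA mul_adj_mx !mul_scalar_mx.
  exact: scalerI.
pose x0 := adj_velocity eps p g.
have Mx0 : M *m x0 = p.
  rewrite /x0 /adj_velocity -/M -scalemxAr mulmxA mul_mx_adj mul_scalar_mx.
  by rewrite scalerA mulVf// scale1r.
(* [legendre_mx] preserves the normal component, so the solution for a tangent [p] is itself
   tangent. *)
have gx0 : dotv g x0 = 0.
  rewrite -gp -Mx0 legendre_mxE dotvDr dotvZr gg legendre_tangent addr0 mulr1//.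
have : [set x | dotv g x = 0 /\ p = legendre I eps g x] x.
  by apply: getPex; exists x0; split => //; rewrite -{1}Mx0 legendre_mxE gx0 scale0r add0r.
move=> [gx px]; split=> //; apply: inj.
by rewrite Mx0 legendre_mxE gx scale0r add0r -px.
Qed.

End InertiaOperator.

(** * The inertia restricted to v_gamma *)

Section ReducedInertia.
Variables (R : realType) (k : nat).
Variable I : {linear 'M[R]_k.+1 -> 'M[R]_k.+1}.
Hypothesis HI : inertia_operator I.
Implicit Types (E : 'M[R]_(k.+1, k)) (g : 'cV[R]_k.+1).

Definition frame_inertia E g : 'M[R]_k := - (E^T *m theta I g g *m E).

Lemma frame_inertia_sym E g : (frame_inertia E g)^T = frame_inertia E g.
Proof.
by rewrite /frame_inertia linearN/= !trmx_mul trmxK theta_tr// mulmxA.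
Qed.

Lemma det_frame_inertia_gt0 E g : dotv g g = 1 -> is_frame E g ->
  0 < \det (frame_inertia E g).
Proof.
move=> gg [EE Eg]; apply: det_posdef_gt0 => h h0.
rewrite mulNmx dotvNr -!mulmxA dotv_mulmx trmxK oppr_gt0; apply: theta_neg => //.
apply: contra_neq h0 => w0.
have : wedgev g (E *m h) *m g = - (E *m h).
  rewrite wedgev_mul gg scale1r (dotvC _ g) dotv_mulmx.
  have -> : dotv (E^T *m g) h = 0 by rewrite Eg dotvC dotv0r.
  by rewrite scale0r sub0r.
rewrite w0 mul0mx => /eqP; rewrite eq_sym oppr_eq0 => /eqP Eh.
by rewrite -[h]mul1mx -EE -mulmxA Eh mulmx0.
Qed.

(** The wedges e_i /\ g form a basis of v_gamma with dual functionals A -> (e_i, A g), and [pr_v]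
    sends an antisymmetric matrix A to (A g) /\ g. *)
Lemma det_v_frame E g : dotv g g = 1 -> is_frame E g ->
  det_v I g = \det (frame_inertia E g).
Proof.
move=> gg fE; have [EE Eg] := fE.
pose b (i : 'I_k) := wedgev (col i E) g.
have ET (x : 'cV[R]_k.+1) i : (E^T *m x) i 0 = dotv (col i E) x.
  by rewrite /dotv mxE [RHS]mxE; apply: eq_bigr => j _; rewrite !mxE.
have wb x : wedgev x g = \sum_i dotv (col i E) x *: b i.
  rewrite {1}(frame_decomp x gg fE) wedgevDl wedgevZl wedgevv scaler0 addr0.
  rewrite -[E *m _]/(E *m (E^T *m x)) -[LHS]/(wedge_with g _).
  have -> : E *m (E^T *m x) = \sum_i dotv (col i E) x *: col i E.
    apply/matrixP => i j; rewrite (ord1 j) mxE summxE; apply: eq_bigr => l _.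
    by rewrite -ET mulrC [RHS]mxE [col _ _ _ _]mxE.
  by rewrite linear_sum; apply: eq_bigr => i _; rewrite linearZ.
have betaP i : linear (fun A : 'M[R]_k.+1 => dotv (col i E) (A *m g) : R^o).
  by move=> a A B; rewrite mulmxDl -scalemxAl dotvDr dotvZr.
pose beta i : {linear 'M[R]_k.+1 -> R^o} :=
  HB.pack (fun A : 'M[R]_k.+1 => dotv (col i E) (A *m g) : R^o)
    (GRing.isLinear.Build _ _ _ _ _ (betaP i)).
have gcol i : dotv (col i E) g = 0 by rewrite -ET Eg mxE.
have betaw i x : beta i (wedgev x g) = dotv (col i E) x.
  rewrite /= wedgev_mul gg scale1r dotvDr dotvNr dotvZr gcol mulr0 subr0//.
rewrite /det_v; apply: (det_on_basis (b := b) (beta := beta)).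
- move=> i; rewrite /v_space; apply/memv_imgP; exists (col i E); rewrite ?memvf//.
  by rewrite lfunE.
- move=> u /memv_imgP[x _ ->]; rewrite lfunE /= -[wedge_with g x]/(wedgev x g).
  by rewrite {1}wb; apply: eq_bigr => i _; rewrite -betaw.
- move=> i j; rewrite betaw -ET; move/matrixP: EE => /(_ i j).
  rewrite mxE [RHS]mxE => <-; rewrite mxE.
  by apply: eq_bigr => l _; rewrite [col _ _ _ _]mxE.
move=> c; set A := \sum_j c j *: b j.
have AE : A = wedgev (\sum_j c j *: col j E) g.
  rewrite /A -[RHS]/(wedge_with g _) linear_sum; apply: eq_bigr => j _.
  by rewrite linearZ.
have sA : so (I A) by rewrite AE; exact: inertia_so.
have -> : (pr_v g \o I) A = wedgev (I A *m g) g.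
  rewrite /= /pr_v /wedgev /tensv mulmxA; congr (_ + _).
  by rewrite trmx_mul sA !mulmxN opprK mulmxA.
rewrite wb {1}/A.
rewrite (eq_bigr (fun i => \sum_j c j *: (frame_inertia E g i j *: b i))).
  by rewrite exchange_big; apply: eq_bigr => j _; rewrite scaler_sumr.
move=> i _; rewrite linear_sum mulmx_suml.
have -> : dotv (col i E) (\sum_j I (c j *: b j) *m g) =
    \sum_j c j * frame_inertia E g i j.
  rewrite -ET mulmx_sumr summxE; apply: eq_bigr => j _.
  rewrite linearZ -scalemxAl -scalemxAr mxE thetaNE; congr (_ * _).
  rewrite mulmxN mulmxA [LHS]mxE [RHS]mxE; congr (- _).
  rewrite [LHS]mxE [RHS]mxE; apply: eq_bigr => l _.
  by rewrite [col _ _ _ _]mxE.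
by rewrite scaler_suml; apply: eq_bigr => j _; rewrite scalerA.
Qed.

End ReducedInertia.

(** * The linearized equations in frame coordinates *)

Section Linearization.
Variables (R : realType) (k : nat).
Variable I : {linear 'M[R]_k.+1 -> 'M[R]_k.+1}.
Hypothesis HI : inertia_operator I.
Variables (eps lam : R) (E : 'M[R]_(k.+1, k)) (p g x : 'cV[R]_k.+1).
Hypotheses (eps0 : eps != 0) (gg : dotv g g = 1) (fE : is_frame E g).

Let c := (1 - eps) / eps ^+ 3.
Let A := I (wedgev g x).
Let B := frame_inertia I E g.
Let Q := E^T *m theta I g x *m E.
Let S := E^T *m A *m E.

Let B_unit : B \in unitmx.
Proof. by rewrite unitmxE unitfE gt_eqF// det_frame_inertia_gt0. Qed.

Let S_so : so S.
Proof.
rewrite /so/= /S !trmx_mul trmxK (inertia_so HI g x) mulmxA mulmxN mulNmx//.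
Qed.

Let invB_sym : (invmx B)^T = invmx B.
Proof. by rewrite trmx_inv frame_inertia_sym. Qed.

Let Qtr : Q^T = E^T *m theta I x g *m E.
Proof. by rewrite /Q !trmx_mul trmxK theta_tr// mulmxA. Qed.

(** Collects what multiplies the position coordinates in the momentum equation without passing
    through [E^T *m dx]. It sits off the diagonal of [Z], so the multiplier [lam] never reaches the
    trace. *)
Let Y := - (c *: (E^T *m theta I x x *m E))
  - c *: (E^T *m A *m g *m x^T *m E) + lam%:M + E^T *m x *m p^T *m E.

(* The linearized equations in the frame coordinates of momentum and position,
   for a frame moving with the velocity - g (x, E). *)
Let Z : 'M[R]_(k + k) :=
  block_mx ((c * eps ^+ 2) *: ((Q + S) *m invmx B))
    (c *: ((Q + S) *m (invmx B *m (S - Q^T))) + Y)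
    (eps ^+ 2 *: invmx B) (invmx B *m (S - Q^T)).

(** [S] is antisymmetric and [invmx B] symmetric, so their products are traceless. What remains is c
    eps^2 = (1 - eps) / eps from the momentum block and -1 from the position block. *)
Let mxtrace_Z : \tr Z = (1 - 2 * eps) / eps * \tr (Q *m invmx B).
Proof.
have SB : \tr (S *m invmx B) = 0 by exact: trmx_mul_eq0.
have BS : \tr (invmx B *m S) = 0 by rewrite mxtrace_mulC.
have BQ : \tr (invmx B *m Q^T) = \tr (Q *m invmx B).
  by rewrite -mxtrace_tr trmx_mul trmxK invB_sym.
rewrite /Z mxtrace_block linearZ/= mulmxDl linearD/= SB mulmxBr linearB/=.
rewrite BS BQ /c; field; exact: eps0.
Qed.

Let ZE (q h dx dp : 'cV[R]_k.+1) (mu : R) :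
  dotv g h = 0 -> dotv h p + dotv g q = 0 -> dotv h x + dotv g dx = 0 ->
  q = - (eps ^+ 2)^-1 *:
    (I (wedgev h x + wedgev g dx) *m g + I (wedgev g x) *m h) ->
  dp = c *: (I (wedgev h x + wedgev g dx) *m x + I (wedgev g x) *m dx)
    + lam *: h + mu *: g ->
  col_mx (E^T *m dp - E^T *m x *m g^T *m q)
    (E^T *m dx - E^T *m x *m g^T *m h) = Z *m col_mx (E^T *m q) (E^T *m h).
Proof.
move=> gh hpq hxd qE dpE; have [EE Eg] := fE.
set hb := E^T *m h; set qb := E^T *m q; set K := E^T *m dx.
have hE : h = E *m hb.
  by rewrite {1}(frame_decomp h gg fE) gh scale0r addr0.
have dxE : dx = E *m K - dotv h x *: g.
  rewrite {1}(frame_decomp dx gg fE) -scaleNr; congr (_ + _ *: _).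
  by apply/eqP; rewrite -addr_eq0 addrC hxd.
(* The linearized Legendre relation, to be solved for the tangential part [K] of [dx]; the normal
   part of [dx] disappears because theta g g kills g. *)
have BK : B *m K = eps ^+ 2 *: qb + (S - Q^T) *m hb.
  have -> : qb = - (eps ^+ 2)^-1 *: (- (Q^T *m hb) - B *m K + S *m hb).
    rewrite /qb qE -scalemxAr; congr (_ *: _).
    rewrite (linearD I) mulmxDl (thetaNE I x g) (thetaE I g g dx).
    rewrite !mulmxDr mulmxN Qtr.
    congr (- _ + _ + _).
    - by rewrite {1}hE !mulmxA.
    - rewrite {1}dxE mulmxBr -scalemxAr theta_mul_same scaler0 subr0.
      by rewrite /B /frame_inertia mulNmx opprK !mulmxA.
    - by rewrite {1}hE !mulmxA.
  rewrite scalerA mulrN divff ?expf_neq0// scaleN1r mulmxBl.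
  move: (Q^T *m hb) (B *m K) (S *m hb) => a b s.
  by apply/matrixP => i j; rewrite !mxE; ring.
have KE : K = eps ^+ 2 *: (invmx B *m qb) + invmx B *m (S - Q^T) *m hb.
  by rewrite -[LHS](mulKmx B_unit) BK mulmxDr -scalemxAr (mulmxA _ _ hb).
rewrite /Z mul_block_col; congr col_mx; last first.
  by rewrite -mulmxA mx11_dotv gh mul_mx_scalar scale0r subr0 -scalemxAl.
(* Tangency makes the normal component of [q] equal to - (h, p), so the velocity of the frame
   contributes only a position term, the last one of [Y]. *)
have gqE : E^T *m x *m g^T *m q = - (E^T *m x *m p^T *m E *m hb).
  rewrite -(mulmxA _ E) -hE -!(mulmxA (E^T *m x)) !mx11_dotv -mulmxN.
  congr (_ *m _); rewrite -raddfN/=; congr (_%:M).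
  by apply/eqP; rewrite -addr_eq0 addrC (dotvC p) hpq.
have EdpE : E^T *m dp = c *: (- (E^T *m theta I x x *m E *m hb)
    + (Q + S) *m K - E^T *m A *m g *m x^T *m E *m hb) + lam *: hb.
  rewrite dpE !mulmxDr -!scalemxAr Eg scaler0 addr0; congr (_ *: _ + _).
  rewrite (linearD I) (mulmxDl _ _ x) (thetaNE I x x) (thetaE I g x dx).
  rewrite !(mulmxDr E^T) mulmxN (mulmxDl _ _ K).
  rewrite -!addrA; congr (_ + _); first by rewrite {1}hE !mulmxA.
  congr (_ + _).
    rewrite {1}dxE mulmxBr -scalemxAr theta_mul_same scaler0 subr0.
    by rewrite !mulmxA.
  rewrite -/A {1}dxE !mulmxBr; congr (_ - _); first by rewrite !mulmxA.
  rewrite -!scalemxAr -(mulmxA _ E) -hE -!(mulmxA _ x^T) mx11_dotv.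
  by rewrite mul_mx_scalar (dotvC x) -!mulmxA.
have KQ : (Q + S) *m K = eps ^+ 2 *: ((Q + S) *m invmx B *m qb)
    + (Q + S) *m (invmx B *m (S - Q^T)) *m hb.
  by rewrite KE mulmxDr -scalemxAr (mulmxA _ _ qb) (mulmxA _ _ hb).
have YE : Y *m hb = - (c *: (E^T *m theta I x x *m E *m hb))
    - c *: (E^T *m A *m g *m x^T *m E *m hb) + lam *: hb
    + E^T *m x *m p^T *m E *m hb.
  by rewrite /Y !(mulmxDl _ _ hb) !mulNmx -!(scalemxAl c) mul_scalar_mx.
rewrite gqE opprK EdpE KQ (mulmxDl _ _ hb) YE -!scalemxAl.
move: (_ *m qb) (_ *m hb) (_ *m hb) (_ *m hb) (_ *m hb) => a1 a2 a3 a4 a5.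
by clearbody hb; apply/matrixP => i j; rewrite !mxE; ring.
Qed.

(** A single [Z'], chosen before the variations, serves all rows of the coordinate matrix at once.
    Vectors are rows there, whence the transpose of [Z]. *)
Lemma linearization : exists Z' : 'M[R]_(k + k),
  \tr Z' = (1 - 2 * eps) / eps * \tr (Q *m invmx B) /\
  forall (q h dx dp : 'cV[R]_k.+1) (mu : R),
  dotv g h = 0 -> dotv h p + dotv g q = 0 -> dotv h x + dotv g dx = 0 ->
  q = - (eps ^+ 2)^-1 *:
    (I (wedgev h x + wedgev g dx) *m g + I (wedgev g x) *m h) ->
  dp = c *: (I (wedgev h x + wedgev g dx) *m x + I (wedgev g x) *m dx)
    + lam *: h + mu *: g ->
  row_mx (dp^T *m E - q^T *m (g *m (x^T *m E)))
    (dx^T *m E - h^T *m (g *m (x^T *m E)))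
  = row_mx (q^T *m E) (h^T *m E) *m Z'.
Proof.
exists Z^T; split; first by rewrite mxtrace_tr.
move=> q h dx dp mu gh hpq hxd qE dpE.
have tr a b : a^T *m E - b^T *m (g *m (x^T *m E))
    = (E^T *m a - E^T *m x *m g^T *m b)^T.
  by rewrite linearB/= !trmx_mul !trmxK -?mulmxA.
by rewrite !tr -tr_col_mx (ZE gh hpq hxd qE dpE) trmx_mul tr_col_mx !trmx_mul trmxK.
Qed.

End Linearization.

(** * Time and parameter derivatives of the flow *)

Section Increments.
Variable R : realType.

Lemma has_slope_quotient (P : Type) (d : increment R P) h l b :
  inc_step d t @[t --> inc_F d] --> 0 ->
  (\forall t \near inc_F d, inc_step d t != 0) ->
  h (inc_from d t) @[t --> inc_F d] --> l ->
  (h (inc_to d t) - h (inc_from d t)) / inc_step d t @[t --> inc_F d] --> b ->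
  has_slope d h l b.
Proof.
move=> st0 stn h0 hq; split=> //.
have : h (inc_from d t) +
    inc_step d t * ((h (inc_to d t) - h (inc_from d t)) / inc_step d t)
    @[t --> inc_F d] --> l + 0 * b.
  by apply: cvgD => //; apply: cvgM.
rewrite mul0r addr0; apply: cvg_trans; apply: near_eq_cvg.
by apply: filterS stn => t tn; rewrite mulrC divfK// addrC subrK.
Qed.

Definition time_increment (tau : R) : increment R R :=
  Increment (Proper_dnbhs_numFieldType (0 : R)) (fun h => h + tau) (fun=> tau) id.

Lemma nonzero_filter (tau : R) :
  ProperFilter (within (fun z : R * R => z.2 != 0) (nbhs (tau, 0 : R))).
Proof.
apply: Build_ProperFilter_ex.
move=> P /nbhs_ballP[e /= e0 He]; exists (tau, e / 2).
have e2 : 0 < e / 2 by rewrite divr_gt0.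
apply: He; last by rewrite /= gt_eqF.
split; first exact: ballxx.
by rewrite /= /ball/= sub0r normrN gtr0_norm// ltr_pdivrMr// ltr_pMr// ltr1n.
Qed.

(** The time tends to [tau] jointly with the parameter tending to 0, because the mean value theorem
    will evaluate parameter quotients at an unknown intermediate time. *)
Definition param_increment (tau : R) : increment R (R * R) :=
  Increment (nonzero_filter tau) id (fun z => (z.1, 0)) (fun z => z.2).

Lemma time_near (tau : R) (P : set R) : (\forall t \near tau, P t) ->
  \forall h \near inc_F (time_increment tau),
    P (inc_to (time_increment tau) h) /\
    P (inc_from (time_increment tau) h).
Proof.
move=> /nbhs_ballP[e /= e0 He]; near=> h; split; apply: He; last exact: ballxx.
rewrite /= /ball/= opprD addrCA subrr addr0 normrN.
by near: h; apply: dnbhs0_lt.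
Unshelve. all: by end_near. Qed.

Lemma param_near (tau : R) (P : set (R * R)) :
  (\forall z \near (tau, 0), P z) ->
  \forall z \near inc_F (param_increment tau),
    P (inc_to (param_increment tau) z) /\
    P (inc_from (param_increment tau) z).
Proof.
move=> /nbhs_ballP[e /= e0 He]; apply: cvg_within; apply/nbhs_ballP.
exists e => //= z [z1 z2]; split; apply: He; split=> //; exact: ballxx.
Qed.

Lemma cvg_param_fst (tau : R) : z.1 @[z --> inc_F (param_increment tau)] --> tau.
Proof. by apply: cvg_within_filter; exact: cvg_fst. Qed.

Lemma cvg_param_snd (tau : R) :
  z.2 @[z --> inc_F (param_increment tau)] --> (0 : R)^'.
Proof.
move=> P /nbhs_ballP[e /= e0 He]; apply/nbhs_ballP; exists e => //= z [_ z2] z0.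
exact: He.
Qed.

Lemma has_slope_is_derive f (tau df : R) :
  has_slope (time_increment tau) f (f tau) df -> is_derive tau 1 f df.
Proof.
move=> [_ _ fq].
have : h^-1 *: ((f \o shift tau) (h *: 1) - f tau) @[h --> 0^'] --> df.
  apply: cvg_trans fq; apply: near_eq_cvg; near=> h => /=.
  by rewrite [h *: 1]mulr1 mulrC.
move=> H; apply: DeriveDef; first by apply/cvg_ex; exists df.
by rewrite /derive; apply: cvg_lim => //; exact: Rhausdorff.
Unshelve. all: by end_near. Qed.

Lemma is_derive_has_slope (V : normedModType R) (f : R -> V) (tau : R) df
    (l : {linear V -> R^o}) : continuous l -> is_derive tau (1 : R) f df ->
  has_slope (time_increment tau) (l \o f) (l (f tau)) (l df).
Proof.
move=> lc [fd fdE]; apply: has_slope_quotient => /=.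
- exact: cvg_within.
- exact: withinT.
- exact: cvg_cst.
have H : h^-1 *: ((f \o shift tau) (h *: 1) - f tau) @[h --> 0^'] --> df.
  by rewrite -fdE; exact: fd.
have : l (h^-1 *: ((f \o shift tau) (h *: 1) - f tau)) @[h --> (0 : R)^'] --> l df.
  by apply: continuous_cvg H; exact: lc.
apply: cvg_trans; apply: near_eq_cvg; near=> h => /=.
by rewrite linearZ linearB/= [h *: 1]mulr1 mulrC.
Unshelve. all: by end_near. Qed.

(** The end points are unordered, since both times and increments may be negative. *)
Lemma MVT_between (f f' : R -> R) (a b : R) :
  (forall t, Num.min a b <= t <= Num.max a b -> is_derive (t : R) (1 : R) f (f' t)) ->
  exists2 c, Num.min a b <= c <= Num.max a b & f b - f a = f' c * (b - a).
Proof.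
move=> H; have HC t : Num.min a b <= t <= Num.max a b -> {for t, continuous f}.
  move=> /H[fd _]; apply: differentiable_continuous.
  by apply/derivable1_diffP.
move: H HC; have [ab|ba] := leP a b => H HC.
- have [||c cab E] := @MVT_segment _ f f' a b ab.
  + by move=> t; rewrite in_itv/= => /andP[/ltW ? /ltW ?]; apply: H; apply/andP.
  + apply: continuous_in_subspaceT => t; rewrite inE/= in_itv/=; exact: HC.
  by move: cab; rewrite in_itv/= => cab; exists c.
- have [||c cab E] := @MVT_segment _ f f' b a (ltW ba).
  + by move=> t; rewrite in_itv/= => /andP[/ltW ? /ltW ?]; apply: H; apply/andP.
  + apply: continuous_in_subspaceT => t; rewrite inE/= in_itv/=; exact: HC.
  move: cab; rewrite in_itv/= => cab; exists c => //.
  by rewrite -opprB E -mulrN opprB.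
Qed.

Lemma between_ball (a b c e x : R) : `|x - a| < e -> `|x - b| < e ->
  Num.min a b <= c <= Num.max a b -> `|x - c| < e.
Proof.
rewrite !ltr_norml => /andP[? ?] /andP[? ?] /andP[].
by case: (leP a b) => h1 h2 h3; apply/andP; split; lra.
Qed.

Lemma param_slice (h : R * R -> R) t l b :
  has_slope (param_increment t) h l b ->
  has_slope (time_increment 0) (fun s => h (t, s)) l b.
Proof.
have slice (f : R * R -> R) c : f z @[z --> inc_F (param_increment t)] --> c ->
    f (t, s) @[s --> (0 : R)^'] --> c.
  move=> H P /H /nbhs_ballP[r /= r0 Hr]; apply/nbhs_ballP.
  exists r => //= s rs sn0; apply: (Hr (t, s)) => //; split=> //.
  exact: ballxx.
move=> [h1 h2 h3]; split=> /=; under eq_fun do rewrite ?addr0.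
- exact: slice h1.
- exact: slice h2.
- exact: slice h3.
Qed.

(* Interchange of the two partial derivatives of h. *)
Lemma slope_slope (h k : R * R -> R) (eta : R -> R) (tau l b : R) :
  (\forall z \near (tau, 0),
    has_slope (time_increment z.1) (fun t => h (t, z.2)) (h z) (k z)) ->
  has_slope (param_increment tau) k l b ->
  (\forall t \near tau, exists l', has_slope (param_increment t) h l' (eta t)) ->
  has_slope (time_increment tau) eta (eta tau) b.
Proof.
move=> hk [_ _ kq] heta; apply: has_slope_quotient => /=.
- exact: cvg_within.
- exact: withinT.
- exact: cvg_cst.
apply/cvgrPdist_le => e e0.
have kq_e := @cvgr_dist_le _ _ _ _ _ _ _ kq e e0.
have /nbhs_ballP[d /= d0 Hd] : \forall z \near (tau, 0),
    (has_slope (time_increment z.1) (fun t => h (t, z.2)) (h z) (k z)) /\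
    (z.2 != 0 -> `|b - (k z - k (z.1, 0)) / z.2| <= e).
  by apply: filterI => //; exact: kq_e.
have /nbhs_ballP[d' /= d'0 Hd'] := heta.
near=> a.
have a0 : a != 0 by near: a; exact: withinT.
have ad : `|a| < d by near: a; exact: dnbhs0_lt.
have ad' : `|a| < d' by near: a; exact: dnbhs0_lt.
have [l1 s1] : exists l', has_slope (param_increment (a + tau)) h l' (eta (a + tau)).
  by apply: Hd'; rewrite /ball/= opprD addrCA subrr addr0 normrN.
have [l0 s0] : exists l', has_slope (param_increment tau) h l' (eta tau).
  by apply: Hd'; exact: ballxx.
have slice t l' c : has_slope (param_increment t) h l' c ->
    (h (t, s) - h (t, 0)) / s @[s --> (0 : R)^'] --> c.
  by move=> /param_slice[_ _] /=; under eq_fun do rewrite addr0.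
have qcvg : ((h (a + tau, s) - h (a + tau, 0)) / s
     - (h (tau, s) - h (tau, 0)) / s) / a @[s --> (0 : R)^']
    --> (eta (a + tau) - eta tau) / a.
  by apply: cvgM; [apply: cvgB; apply: slice; eassumption|exact: cvg_cst].
have : `|b - ((h (a + tau, s) - h (a + tau, 0)) / s
     - (h (tau, s) - h (tau, 0)) / s) / a| @[s --> (0 : R)^']
    --> `|b - (eta (a + tau) - eta tau) / a|.
  by apply: cvg_norm; apply: cvgB => //; exact: cvg_cst.
(* With [a] fixed, it is enough to bound the double difference quotient for small nonzero s: a large
   inequality survives the limit. *)
move=> /cvgr_to_le; apply.
near=> s.
have sn0 : s != 0 by near: s; exact: withinT.
have sd : `|s| < d by near: s; exact: dnbhs0_lt.
have inb t : `|tau - t| < d -> ball (tau, 0 : R) d (t, s) /\ ball (tau, 0 : R) d (t, 0).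
  move=> td; split; split=> //=; last exact: ballxx.
  by rewrite /ball/= sub0r normrN.
have tb t : Num.min tau (a + tau) <= t <= Num.max tau (a + tau) -> `|tau - t| < d.
  apply: between_ball; first by rewrite subrr normr0.
  by rewrite opprD addrCA subrr addr0 normrN.
have sl t : Num.min tau (a + tau) <= t <= Num.max tau (a + tau) ->
    is_derive (t : R) (1 : R) ((fun t => h (t, s)) - (fun t => h (t, 0)))
      (k (t, s) - k (t, 0)).
  move=> /tb/inb[b1 b2]; apply: is_deriveB; apply: has_slope_is_derive.
    exact: (Hd _ b1).1.
  exact: (Hd _ b2).1.
(* Applied in time to the difference of [h] at the parameters s and 0. It turns the double quotient
   into a parameter quotient of [k] at an intermediate time t, which the joint limit controls. *)
have [t /tb tab E] := MVT_between sl.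
rewrite -mulrBl; move: E; rewrite addrK => E.
have -> : (h (a + tau, s) - h (a + tau, 0) - (h (tau, s) - h (tau, 0))) / s / a
   = (k (t, s) - k (t, 0)) / s.
  have -> : h (a + tau, s) - h (a + tau, 0) - (h (tau, s) - h (tau, 0))
    = (k (t, s) - k (t, 0)) * a by exact: E.
  by rewrite mulrAC mulfK.
exact: (Hd _ (inb t tab).1).2.
Unshelve. all: by end_near. Qed.

End Increments.

(** * Parameter derivatives of a C^1 map along a curve *)

Section PhaseSpace.
Variables (R : realType) (n : nat).
Local Notation V := ('cV[R]_n * 'cV[R]_n)%type.

Definition fst_coord (i : 'I_n) (u : V) : R^o := u.1 i 0.
Definition snd_coord (i : 'I_n) (u : V) : R^o := u.2 i 0.

Fact fst_coord_is_linear i : linear (fst_coord i).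
Proof. by move=> a u v; rewrite /fst_coord !mxE. Qed.
Fact snd_coord_is_linear i : linear (snd_coord i).
Proof. by move=> a u v; rewrite /snd_coord !mxE. Qed.

HB.instance Definition _ i :=
  GRing.isLinear.Build R V R^o *:%R (fst_coord i) (fst_coord_is_linear i).
HB.instance Definition _ i :=
  GRing.isLinear.Build R V R^o *:%R (snd_coord i) (snd_coord_is_linear i).

Lemma continuous_fst_coord i : continuous (fst_coord i).
Proof.
move=> u; apply: (@continuous_comp _ _ _ fst (fun M : 'cV[R]_n => M i 0)).
  exact: cvg_fst.
exact: coord_continuous.
Qed.

Lemma continuous_snd_coord i : continuous (snd_coord i).
Proof.
move=> u; apply: (@continuous_comp _ _ _ snd (fun M : 'cV[R]_n => M i 0)).
  exact: cvg_snd.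
exact: coord_continuous.
Qed.

Lemma phase_basis (u : V) :
  u = \sum_i u.1 i 0 *: (delta_mx i 0, 0) + \sum_i u.2 i 0 *: (0, delta_mx i 0).
Proof.
have cE (x : 'cV[R]_n) : x = \sum_i x i 0 *: delta_mx i 0.
  by rewrite {1}[x]matrix_sum_delta; apply: eq_bigr => i _; rewrite big_ord1.
have S1 (F : 'I_n -> V) : (\sum_i F i).1 = \sum_i (F i).1 by exact: raddf_sum.
have S2 (F : 'I_n -> V) : (\sum_i F i).2 = \sum_i (F i).2 by exact: raddf_sum.
case: u => u1 u2; apply/pair_equal_spec; split.
- transitivity ((\sum_i u1 i 0 *: ((delta_mx i 0, 0) : V)).1
      + (\sum_i u2 i 0 *: ((0, delta_mx i 0) : V)).1); last by [].
  rewrite !S1 /= [X in _ + X]big1 ?addr0; first exact: cE.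
  by move=> i _; rewrite scaler0.
- transitivity ((\sum_i u1 i 0 *: ((delta_mx i 0, 0) : V)).2
      + (\sum_i u2 i 0 *: ((0, delta_mx i 0) : V)).2); last by [].
  rewrite !S2 /= [X in X + _]big1 ?add0r; first exact: cE.
  by move=> i _; rewrite scaler0.
Qed.

Lemma cvg_bigsum (U : normedModType R) (T I : Type) (F : set_system T)
    (FF : Filter F) (r : seq I) (f : I -> T -> U) (a : I -> U) :
  (forall i, f i t @[t --> F] --> a i) ->
  \sum_(i <- r) f i t @[t --> F] --> \sum_(i <- r) a i.
Proof.
move=> H; elim: r => [|i r IH].
  by rewrite big_nil; under eq_fun do rewrite big_nil; exact: cvg_cst.
by rewrite big_cons; under eq_fun do rewrite big_cons; exact: cvgD.
Qed.

Lemma cvg_phase (T : Type) (F : set_system T) (FF : Filter F) (f : T -> V) (u : V) :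
  (forall i, (f t).1 i 0 @[t --> F] --> u.1 i 0) ->
  (forall i, (f t).2 i 0 @[t --> F] --> u.2 i 0) -> f t @[t --> F] --> u.
Proof.
move=> f1 f2; rewrite [u]phase_basis.
under eq_fun do rewrite [f _]phase_basis.
by apply: cvgD; apply: cvg_bigsum => i; apply: cvgZr_tmp.
Qed.

(* By the mean value theorem on the segments from mu 0 to mu s, so that mu need
   only be differentiable at 0. *)
Lemma C1_slope (W : set (R * V)) (phi : R * V -> V) (l : {linear V -> R^o})
    (mu : R -> V) (tau : R) (v : V) :
  open W -> C1_on W phi -> continuous l -> W (tau, mu 0) ->
  has_slope_mx (time_increment 0) (fun s => (mu s).1) (mu 0).1 v.1 ->
  has_slope_mx (time_increment 0) (fun s => (mu s).2) (mu 0).2 v.2 ->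
  has_slope (param_increment tau) (fun z => l (phi (z.1, mu z.2)))
    (l (phi (tau, mu 0))) (l ('d phi (tau, mu 0) (0, v))).
Proof.
move=> Wo phiC lc Wm mu1 mu2; set m := mu 0 in Wm *.
pose D z h := l ('d phi z h).
have quot_mu (i : 'I_n) : ((mu z.2 - m).1 i 0 / z.2
    @[z --> inc_F (param_increment tau)] --> v.1 i 0) /\
    ((mu z.2 - m).2 i 0 / z.2
    @[z --> inc_F (param_increment tau)] --> v.2 i 0).
  have [_ _ q1] := mu1 i 0; have [_ _ q2] := mu2 i 0; split.
  - have := cvg_comp _ _ (@cvg_param_snd R tau) q1.
    apply: cvg_trans; apply: near_eq_cvg; near=> z => /=.
    by rewrite addr0 /m !mxE.
  - have := cvg_comp _ _ (@cvg_param_snd R tau) q2.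
    apply: cvg_trans; apply: near_eq_cvg; near=> z => /=.
    by rewrite addr0 /m !mxE.
have mu_cvg : mu z.2 @[z --> inc_F (param_increment tau)] --> m.
  apply: cvg_phase => i.
  - have [+ _ _] := mu1 i 0 => /(cvg_comp _ _ (@cvg_param_snd R tau)).
    apply: cvg_trans; apply: near_eq_cvg; near=> z => /=.
    by rewrite addr0.
  - have [+ _ _] := mu2 i 0 => /(cvg_comp _ _ (@cvg_param_snd R tau)).
    apply: cvg_trans; apply: near_eq_cvg; near=> z => /=.
    by rewrite addr0.
have seg_diff z w t : W (z, m + t *: w) ->
    is_derive (t : R) (1 : R) (fun t : R => l (phi (z, m + t *: w)))
      (D (z, m + t *: w) (0, w)).
  move=> Wz; have [dphi _] := phiC _ Wz.
  have dseg : is_diff t (fun t : R => (z, m + t *: w)) (fun h : R => (0 : R, h *: w)).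
    apply: is_diff_pair.
    have ds : is_diff t (fun h : R => h *: w) (fun h : R => h *: w).
      exact: is_diff_scalel.
    apply: is_diff_eq (is_diffD (is_diff_cst m t) ds) _.
    by rewrite add0r.
  have dl : is_diff (phi (z, m + t *: w)) l l.
    by apply: DiffDef; [exact: linear_differentiable|rewrite diff_lin].
  have dphi' : is_diff (z, m + t *: w) phi ('d phi (z, m + t *: w)).
    exact: DiffDef.
  have [dG dGE] := is_diff_comp (is_diff_comp dseg dphi') dl.
  apply: DeriveDef; first exact: diff_derivable.
  by rewrite deriveE// dGE /= scale1r.
have /nbhs_ballP[e /= e0 He] : nbhs (tau, m) W by exact: open_nbhs_nbhs.
have near_e : \forall z \near inc_F (param_increment tau),
    `|tau - z.1| < e /\ `|mu z.2 - m| < e.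
  apply: filterI.
    exact: (@cvgr_dist_lt _ _ _ _ _ _ _ (@cvg_param_fst R tau) _ e0).
  exact: (@cvgr_distC_lt _ _ _ _ _ _ _ mu_cvg _ e0).
have seg_W z c : `|tau - z.1| < e -> `|mu z.2 - m| < e -> 0 <= c <= 1 ->
    W (z.1, m + c *: (mu z.2 - m)).
  move=> z1 z2 /andP[c0 c1]; apply: He; split=> //=.
  rewrite -ball_normE/= opprD addNKr normrN normrZ ger0_norm//.
  by rewrite (le_lt_trans _ z2)// ler_piMl.
pose S z c := 0 <= c <= 1 /\ l (phi (z.1, mu z.2)) - l (phi (z.1, m)) =
  D (z.1, m + c *: (mu z.2 - m)) (0, mu z.2 - m).
pose c z := get (S z).
have cP : \forall z \near inc_F (param_increment tau), S z (c z).
  apply: filterS near_e => z [z1 z2]; apply: getPex.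
  have [|t t01 E] := @MVT_between R (fun t : R => l (phi (z.1, m + t *: (mu z.2 - m))))
      (fun t => D (z.1, m + t *: (mu z.2 - m)) (0, mu z.2 - m)) 0 1.
    move=> t; rewrite min_l// max_r// => t01; apply: seg_diff.
    exact: seg_W.
  exists t; split; first by move: t01; rewrite min_l// max_r.
  by move: E; rewrite subr0 mulr1 scale1r scale0r addr0 [m + _]addrC subrK.
pose zeta z : R * V := (z.1, m + c z *: (mu z.2 - m)).
have zeta_cvg : zeta z @[z --> inc_F (param_increment tau)] --> (tau, m).
  suff H2 : m + c z *: (mu z.2 - m) @[z --> inc_F (param_increment tau)] --> m.
    exact: (cvg_pair (@cvg_param_fst R tau) H2).
  apply/cvgrPdist_lt => e' e'0.
  have near_mu := @cvgr_distC_lt _ _ _ _ _ _ _ mu_cvg _ e'0.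
  near=> z.
  have [/andP[c0 c1] _] : S z (c z) by near: z; exact: cP.
  have zm : `|mu z.2 - m| < e' by near: z; exact: near_mu.
  rewrite opprD addNKr normrN normrZ ger0_norm//.
  by rewrite (le_lt_trans _ zm)// ler_piMl.
have D_cvg h : D (zeta z) h @[z --> inc_F (param_increment tau)] --> D (tau, m) h.
  have [_ /(_ h) dc] := phiC _ Wm.
  have dlc : {for (tau, m), continuous (fun z => D z h)}.
    by apply: continuous_comp; [exact: dc|exact: lc].
  exact: (cvg_comp _ _ zeta_cvg dlc).
(* The differential is continuous only for each fixed direction, whereas here the direction moves
   with z. Expansion in the coordinate basis leaves fixed directions with convergent
   coefficients. *)
have DE z h : D z (0, h) = \sum_i h.1 i 0 * D z (0, ((delta_mx i 0, 0) : V))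
   + \sum_i h.2 i 0 * D z (0, ((0, delta_mx i 0) : V)).
  have inj2 : linear (fun h : V => D z (0, h) : R^o).
    move=> a u w; rewrite /D -[RHS]/(a *: _ + _) -linearP -linearP.
    congr (l ('d phi z _)); apply/pair_equal_spec; split=> //=.
    by rewrite scaler0 addr0.
  pose Dz : {linear V -> R^o} := HB.pack (fun h : V => D z (0, h) : R^o)
    (GRing.isLinear.Build _ _ _ _ _ inj2).
  transitivity (Dz h) => //; rewrite [in LHS](phase_basis h) linearD !linear_sum.
  by congr (_ + _); apply: eq_bigr => i _; rewrite linearZ.
have l_cvg (f : R * R -> V) : f z @[z --> inc_F (param_increment tau)] --> m ->
    l (phi (z.1, f z)) @[z --> inc_F (param_increment tau)] --> l (phi (tau, m)).
  move=> fm; have [dphi _] := phiC _ Wm.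
  have lphic : {for (tau, m), continuous (fun z => l (phi z))}.
    by apply: continuous_comp; [exact: differentiable_continuous|exact: lc].
  exact: (cvg_comp _ _ (cvg_pair (@cvg_param_fst R tau) fm) lphic).
split.
- exact: (l_cvg (fun z => mu z.2) mu_cvg).
- exact: (l_cvg (fun=> m) (cvg_cst _)).
have : (\sum_i (mu z.2 - m).1 i 0 / z.2 * D (zeta z) (0, ((delta_mx i 0, 0) : V))
   + \sum_i (mu z.2 - m).2 i 0 / z.2 * D (zeta z) (0, ((0, delta_mx i 0) : V)))
   @[z --> inc_F (param_increment tau)] --> D (tau, m) (0, v).
  rewrite DE; apply: cvgD; apply: cvg_bigsum => i; apply: cvgM => //.
  - by have [] := quot_mu i.
  - by have [] := quot_mu i.
apply: cvg_trans; apply: near_eq_cvg; near=> z => /=.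
have [_ E] : S z (c z) by near: z; exact: cP.
rewrite -/m E DE mulrDl !mulr_suml.
by congr (_ + _); apply: eq_bigr => i _; rewrite mulrAC.
Unshelve. all: by end_near. Qed.

End PhaseSpace.

Section VectorSlopes.
Variables (R : realType) (P : Type) (d : increment R P) (n : nat).
Implicit Types (H K : P -> 'cV[R]_n) (x y a b : 'cV[R]_n).

Lemma has_slope_dotv H K x y a b :
  has_slope_mx d H x a -> has_slope_mx d K y b ->
  has_slope d (fun z => dotv (H z) (K z)) (dotv x y) (dotv a y + dotv x b).
Proof.
move=> hH hK; have := has_slope_mxM (has_slope_mx_tr hH) hK.
by move=> /(_ 0 0); rewrite [in X in has_slope _ _ _ X]mxE.
Qed.

Lemma has_slope_mx_wedgev H K x y a b :
  has_slope_mx d H x a -> has_slope_mx d K y b ->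
  has_slope_mx d (fun z => wedgev (H z) (K z)) (wedgev x y)
    (wedgev a y + wedgev x b).
Proof.
move=> hH hK; apply: has_slope_mx_eq.
- apply: has_slope_mxD; first exact: has_slope_mxM hH (has_slope_mx_tr hK).
  exact: has_slope_mxN (has_slope_mxM hK (has_slope_mx_tr hH)).
- by [].
- by rewrite /wedgev /tensv [b *m _ + _]addrC opprD addrACA.
Qed.

Lemma has_slope_mx_theta (I : {linear 'M[R]_n -> 'M[R]_n}) H K x y a b :
  has_slope_mx d H x a -> has_slope_mx d K y b ->
  has_slope_mx d (fun z => theta I (H z) (K z)) (theta I x y)
    (theta I a y + theta I x b).
Proof.
move=> hH hK; have S j := has_slope_mxM (has_slope_mx_linear I
  (has_slope_mx_wedgev hH (has_slope_mx_cst d (delta_mx j 0)))) hK.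
have E u w i j : theta I u w i j = (I (wedgev u (delta_mx j 0)) *m w) i 0.
  by rewrite [LHS]mxE.
move=> i j; rewrite [X in has_slope _ _ _ X]mxE !E.
under [X in has_slope _ X]funext do rewrite E.
apply: (has_slope_eq (S j i 0)) => //.
rewrite (_ : wedgev x 0 = 0) ?addr0; first by rewrite mxE.
by rewrite /wedgev /tensv trmx0 mulmx0 mul0mx subrr.
Qed.

End VectorSlopes.

(** * Curves in phase space and the flow along them *)

Section Curves.
Variables (R : realType) (n : nat).
Local Notation V := ('cV[R]_n * 'cV[R]_n)%type.

Lemma has_slope_id (tau : R) : has_slope (time_increment tau) id tau 1.
Proof.
apply: has_slope_quotient => /=.
- exact: cvg_within.
- exact: withinT.
- exact: cvg_cst.
have : (1 : R) @[h --> (0 : R)^'] --> (1 : R) by exact: cvg_cst.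
apply: cvg_trans; apply: near_eq_cvg; near=> h.
by rewrite addrK divff//; near: h; exact: withinT.
Unshelve. all: by end_near. Qed.

(* Stereographic projection parametrizes a great circle rationally. *)
Lemma exists_curve (m v : V) : cotangent_sphere m ->
  tangent_cotangent_sphere m v ->
  exists mu : R -> V, [/\ mu 0 = m, forall s, cotangent_sphere (mu s),
    has_slope_mx (time_increment 0) (fun s => (mu s).1) m.1 v.1
    & has_slope_mx (time_increment 0) (fun s => (mu s).2) m.2 v.2].
Proof.
case: m v => p g [q h] [/= gg gp] [/= gh hq].
(* Chosen so that (1 - kap)^2 + s^2 |h|^2 = (1 + kap)^2, which keeps [G s] on the unit sphere. *)
pose kap s : R := s * s * (dotv h h / 4).
pose G s := (1 + kap s)^-1 *: ((1 - kap s) *: g + s *: h).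
(* Removing the component along [G s] keeps the momentum cotangent; the tangency condition on (q, h)
   makes the first-order correction vanish at s = 0. *)
pose Q s := p + s *: q - dotv (G s) (p + s *: q) *: G s.
have kap0 : kap 0 = 0 by rewrite /kap !mul0r.
have kap_ge0 s : 0 <= kap s.
  by rewrite mulr_ge0 ?divr_ge0 ?dotv_ge0// -expr2 sqr_ge0.
have G0 : G 0 = g by rewrite /G kap0 addr0 invr1 subr0 scale0r addr0 !scale1r.
have GG s : dotv (G s) (G s) = 1.
  have k0 : 1 + kap s != 0 by rewrite gt_eqF// ltr_wpDr.
  rewrite /G dotvZl dotvZr dotvDl !dotvDr !dotvZl !dotvZr gg (dotvC h g) gh.
  have -> : s * (s * dotv h h) = 4 * kap s by rewrite /kap; field.
  by field.
have slope_id := has_slope_id 0.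
have skap : has_slope (time_increment 0) kap 0 0.
  have := has_slopeM (has_slopeM slope_id slope_id)
    (has_slope_cst (time_increment 0) (dotv h h / 4)).
  by move=> H; apply: has_slope_eq H _ _; rewrite !(mulr0, mul0r, addr0).
have sG : has_slope_mx (time_increment 0) G g h.
  have s1 := has_slopeD (has_slope_cst (time_increment 0) 1) skap.
  have s2 := has_slopeV (h := fun s => 1 + kap s) _ s1.
  have s3 := has_slopeD (has_slope_cst (time_increment 0) 1) (has_slopeN skap).
  apply: has_slope_mx_eq.
  - apply: has_slope_mxZ; first by apply: s2; rewrite addr0 oner_neq0.
    apply: has_slope_mxD.
      exact: has_slope_mxZ s3 (has_slope_mx_cst _ g).
    exact: has_slope_mxZ slope_id (has_slope_mx_cst _ h).
  - by rewrite !(addr0, oppr0, invr1, scale1r, scale0r).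
  - rewrite !(addr0, oppr0, invr1, scale1r, scale0r, mul0r, scaler0).
    by rewrite !add0r.
exists (fun s => (Q s, G s)); split => //=.
- by rewrite /Q G0 scale0r addr0 gp scale0r subr0.
- move=> s; split => /=; first exact: GG.
  by rewrite /Q dotvDr dotvNr dotvZr GG mulr1 subrr.
have sP : has_slope_mx (time_increment 0) (fun s => p + s *: q) p q.
  apply: has_slope_mx_eq.
  - apply: has_slope_mxD; first exact: has_slope_mx_cst.
    exact: has_slope_mxZ slope_id (has_slope_mx_cst _ q).
  - by rewrite scale0r addr0.
  - by rewrite scaler0 scale1r addr0 add0r.
apply: has_slope_mx_eq.
- apply: has_slope_mxD; first exact: sP.
  exact: has_slope_mxN (has_slope_mxZ (has_slope_dotv sG sP) sG).
- by rewrite gp scale0r subr0.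
- by rewrite hq gp !scale0r addr0 subr0.
Qed.

Lemma diff_partial (phi : R * V -> V) (tau : R) (m v : V) :
  differentiable phi (tau, m) ->
  'd (fun x => phi (tau, x)) m v = 'd phi (tau, m) (0, v).
Proof.
move=> dphi; have dphi' : is_diff (tau, m) phi ('d phi (tau, m)).
  exact: DiffDef.
have dpair : is_diff m (fun x : V => (tau, x)) (fun x : V => (0 : R, x)).
  by apply: is_diff_pair.
have [_ E] := is_diff_comp dpair dphi'.
by rewrite -[LHS]/('d (phi \o pair tau) m v) E.
Qed.

Variables (M : set V) (X : V -> V) (W : set (R * V)) (phi : R * V -> V).
Hypothesis phi_flow : local_flow M X W phi.
Variables (mu : R -> V) (v : V).
Hypothesis mu1 : has_slope_mx (time_increment 0) (fun s => (mu s).1) (mu 0).1 v.1.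
Hypothesis mu2 : has_slope_mx (time_increment 0) (fun s => (mu s).2) (mu 0).2 v.2.

Lemma flow_slope tau : W (tau, mu 0) ->
  has_slope_mx (param_increment tau) (fun z => (phi (z.1, mu z.2)).1)
    (phi (tau, mu 0)).1 ('d (fun x => phi (tau, x)) (mu 0) v).1 /\
  has_slope_mx (param_increment tau) (fun z => (phi (z.1, mu z.2)).2)
    (phi (tau, mu 0)).2 ('d (fun x => phi (tau, x)) (mu 0) v).2.
Proof.
move=> Wt; have Wo := flow_open phi_flow; have phiC := flow_C1 phi_flow.
have [dphi _] := phiC _ Wt; rewrite diff_partial//.
split=> i j; rewrite (ord1 j).
- exact: (C1_slope Wo phiC (@continuous_fst_coord R n i) Wt mu1 mu2).
- exact: (C1_slope Wo phiC (@continuous_snd_coord R n i) Wt mu1 mu2).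
Qed.

Lemma flow_near tau : W (tau, mu 0) ->
  \forall z \near (tau, 0), W (z.1, mu z.2).
Proof.
move=> Wt; have mu_cont : mu s @[s --> (0 : R)] --> mu 0.
  have cont (f : R -> R) b : has_slope (time_increment 0) f (f 0) b ->
      f s @[s --> (0 : R)] --> f 0.
    move=> /has_slope_is_derive[fd _]; apply: differentiable_continuous.
    by apply/derivable1_diffP.
  by apply: cvg_phase => i; [exact: cont (mu1 i 0)|exact: cont (mu2 i 0)].
have H2 : mu z.2 @[z --> (tau, 0 : R)] --> mu 0.
  exact: (cvg_comp _ _ (@cvg_snd _ _ (nbhs tau) (nbhs (0 : R)) _) mu_cont).
have H1 : z.1 @[z --> (tau, 0 : R)] --> tau by exact: cvg_fst.
have H12 : (z.1, mu z.2) @[z --> (tau, 0 : R)] --> (tau, mu 0).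
  exact: (cvg_pair H1 H2).
exact: (H12 W (open_nbhs_nbhs (conj (flow_open phi_flow) Wt))).
Qed.

Lemma flow_time_slope t m : M m -> W (t, m) ->
  has_slope_mx (time_increment t) (fun s => (phi (s, m)).1) (phi (t, m)).1
    (X (phi (t, m))).1 /\
  has_slope_mx (time_increment t) (fun s => (phi (s, m)).2) (phi (t, m)).2
    (X (phi (t, m))).2.
Proof.
move=> Mm Wt; have D := flow_ode phi_flow Mm Wt.
split=> i j; rewrite (ord1 j).
- exact: (is_derive_has_slope (@continuous_fst_coord R n i) D).
- exact: (is_derive_has_slope (@continuous_snd_coord R n i) D).
Qed.

(** The time-0 map is known to be the identity on [M] only, so its ambient differential is tested
    along a curve inside [M]. *)
Lemma flow_diff_init : (forall s, M (mu s)) -> W (0, mu 0) ->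
  'd (fun x => phi (0, x)) (mu 0) v = v.
Proof.
move=> Mmu W0; have [s1 s2] := flow_slope W0.
have init (b : V -> 'cV[R]_n) i :
  has_slope_mx (time_increment 0) (fun s => b (mu s)) (b (mu 0)) (b v) ->
  has_slope_mx (param_increment 0) (fun z => b (phi (z.1, mu z.2)))
    (b (phi (0, mu 0))) i -> i = b v.
  move=> sb sphi; have {}sphi : has_slope_mx (time_increment 0)
      (fun s => b (phi (0, mu s))) (b (phi (0, mu 0))) i.
    by move=> j k; exact: param_slice (sphi j k).
  apply: (has_slope_mx_uniq _ sphi sb).2.
  apply: (@time_near _ _ (fun s => b (phi (0, mu s)) = b (mu s))).
  have /nbhs_ballP[e /= e0 He] := flow_near W0.
  apply/nbhs_ballP; exists e => //= s es; congr b.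
  apply: (flow_init phi_flow (Mmu s)).
  by apply: (He (0, s)); split => //; exact: ballxx.
have E1 := init fst _ mu1 s1; have E2 := init snd _ mu2 s2.
by rewrite [LHS]surjective_pairing E1 E2 -surjective_pairing.
Qed.

End Curves.

(** * The variational equation *)

Section Variation.
Variables (R : realType) (n : nat) (I : {linear 'M[R]_n -> 'M[R]_n}) (eps : R).
Hypotheses (HI : inertia_operator I) (eps0 : eps != 0).
Local Notation V := ('cV[R]_n * 'cV[R]_n)%type.
Variables (W : set (R * V)) (phi : R * V -> V).
Hypothesis phi_flow :
  local_flow (@cotangent_sphere R n) (rubber_ball_field I eps) W phi.

Lemma adj_velocity_slope (P : Type) (d : increment R P) (p g : P -> 'cV[R]_n)
    p0 g0 q h : dotv g0 g0 = 1 ->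
  has_slope_mx d p p0 q -> has_slope_mx d g g0 h ->
  exists dx, has_slope_mx d (fun z => adj_velocity I eps (p z) (g z))
    (adj_velocity I eps p0 g0) dx.
Proof.
move=> gg sp sg; have sT := has_slope_mx_theta I sg sg.
have sL := has_slope_mxD (has_slope_mxM sg (has_slope_mx_tr sg))
  (has_slope_mxN (has_slope_mxZ (has_slope_cst d (eps ^+ 2)^-1) sT)).
have [dA sA] := has_slope_mx_adj sL.
have d0 := lt0r_neq0 (det_legendre_mx_gt0 HI eps0 gg).
eexists; exact: (has_slope_mxZ (has_slopeV d0 (has_slope_det sL))
  (has_slope_mxM sA sp)).
Qed.

Variables (m v : V) (tau : R).
Hypotheses (Mm : cotangent_sphere m) (Tv : tangent_cotangent_sphere m v)
  (Wm : W (tau, m)).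
Let xi t : V := 'd (fun y => phi (t, y)) m v.
Let p := (phi (tau, m)).1.
Let g := (phi (tau, m)).2.
Let x := X_gamma I eps p g.
Let q := (xi tau).1.
Let h := (xi tau).2.

(** The relations along [phi (t, mu s)] are differentiated in s: the two constraints, tangency of
    the velocity, the Legendre relation and the formula for the force. The interchange lemma then
    identifies the results with time derivatives of [xi]. The scalar [a] absorbs the derivative of
    the multiplier of [g]. *)
Lemma variation : exists dx dp (a : R),
  [/\ dotv g h = 0, dotv h p + dotv g q = 0, dotv h x + dotv g dx = 0,
      q = - (eps ^+ 2)^-1 *:
        (I (wedgev h x + wedgev g dx) *m g + I (wedgev g x) *m h)
    & dp = (1 - eps) / eps ^+ 3 *:
        (I (wedgev h x + wedgev g dx) *m x + I (wedgev g x) *m dx)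
      + ((eps - 1) / eps ^+ 3 * dotv (I (wedgev g x) *m x) g - dotv x p) *: h
      + a *: g] /\
  has_slope_mx (time_increment tau) (fun t => (xi t).1) q dp /\
  has_slope_mx (time_increment tau) (fun t => (xi t).2) h dx.
Proof.
have [mu [mu0 Mmu mu1 mu2]] := exists_curve Mm Tv; rewrite -mu0 in mu1 mu2.
have Wmu : W (tau, mu 0) by rewrite mu0.
pose pz z := (phi (z.1, mu z.2)).1.
pose gz z := (phi (z.1, mu z.2)).2.
pose xz z := adj_velocity I eps (pz z) (gz z).
have slope t : W (t, m) ->
    has_slope_mx (param_increment t) pz (phi (t, m)).1 (xi t).1 /\
    has_slope_mx (param_increment t) gz (phi (t, m)).2 (xi t).2.
  by move=> Wt; have := flow_slope phi_flow mu1 mu2; rewrite mu0; apply.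
have [sp sg] := slope tau Wm.
have [gg gp] : cotangent_sphere (phi (tau, m)) by exact: (flow_mem phi_flow Mm Wm).
have [gx px xE] := X_gammaP HI eps0 gg gp.
have [dx sx] := adj_velocity_slope gg sp sg; rewrite -xE in sx.
have nearW := flow_near phi_flow mu1 mu2 Wmu.
have near_rel : \forall z \near (tau, 0 : R), W (z.1, mu z.2) /\
    [/\ dotv (gz z) (gz z) = 1, dotv (gz z) (pz z) = 0, dotv (gz z) (xz z) = 0,
      pz z = legendre I eps (gz z) (xz z) & X_gamma I eps (pz z) (gz z) = xz z].
  apply: filterS nearW => z Wz; split=> //.
  have [ggz gpz] := flow_mem phi_flow (Mmu z.2) Wz.
  by have [gxz pxz xzE] := X_gammaP HI eps0 ggz gpz; rewrite /xz -xzE.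
have near_inc (T : Type) (a b : R * R -> T) :
    (\forall z \near (tau, 0 : R), a z = b z) ->
    \forall t \near inc_F (param_increment tau),
      a (inc_to (param_increment tau) t) = b (inc_to (param_increment tau) t) /\
      a (inc_from (param_increment tau) t) = b (inc_from (param_increment tau) t).
  exact: param_near.
have sw := has_slope_mx_linear I (has_slope_mx_wedgev sg sx).
have suz := has_slope_mxM sw sx.
have s1 := has_slope_dotv sg sx.
have sl1 := has_slopeZ ((eps - 1) / eps ^+ 3) (has_slope_dotv suz sg).
have slam := has_slopeD sl1 (has_slopeN (has_slope_dotv sx sp)).
have sX := has_slope_mxD
  (has_slope_mxZ (has_slope_cst (param_increment tau) ((1 - eps) / eps ^+ 3)) suz)
  (has_slope_mxZ slam sg).
(* The force rewritten with [adj_velocity]; it agrees with [X_p] at the points of the flow. *)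
pose Xz z := (1 - eps) / eps ^+ 3 *: (I (wedgev (gz z) (xz z)) *m xz z) +
  ((eps - 1) / eps ^+ 3 * dotv (I (wedgev (gz z) (xz z)) *m xz z) (gz z)
    - dotv (xz z) (pz z)) *: gz z.
have [a sXz] : exists a : R, has_slope_mx (param_increment tau) Xz
    (Xz (tau, 0)) ((1 - eps) / eps ^+ 3 *:
        (I (wedgev h x + wedgev g dx) *m x + I (wedgev g x) *m dx)
      + ((eps - 1) / eps ^+ 3 * dotv (I (wedgev g x) *m x) g - dotv x p) *: h
      + a *: g).
  eexists; apply: (has_slope_mx_eq sX).
    by rewrite /Xz /xz /pz /gz /= mu0 -xE.
  by rewrite scale0r add0r -[RHS]addrA; congr (_ + _); exact: addrC.
have time_near_W : \forall t \near tau, W (t, m).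
  have /nbhs_ballP[e /= e0 He] := near_rel.
  apply/nbhs_ballP; exists e => //= t te.
  have [|+ _] := He (t, 0); first by split=> //; exact: ballxx.
  by rewrite /= mu0.
have timez : \forall z \near (tau, 0 : R),
    has_slope_mx (time_increment z.1) (fun t => pz (t, z.2)) (pz z) (Xz z) /\
    has_slope_mx (time_increment z.1) (fun t => gz (t, z.2)) (gz z) (xz z).
  apply: filterS near_rel => z [Wz [_ _ _ _ xzE]].
  have := flow_time_slope phi_flow (Mmu z.2) Wz.
  by rewrite /rubber_ball_field /X_p /= xzE.
exists dx; eexists; exists a; split; last split.
- split.
  + have [] := has_slope_uniq (k := fun=> 1) _ (has_slope_dotv sg sg)
      (has_slope_cst _ 1).
      by apply: (near_inc _ (fun z => dotv (gz z) (gz z)) (fun=> 1)); apply: filterS near_rel => z [_ []].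
    by move=> _; rewrite (dotvC _ g) => /eqP; rewrite -mulr2n mulrn_eq0/= => /eqP.
  + have [] := has_slope_uniq (k := fun=> 0) _ (has_slope_dotv sg sp)
      (has_slope_cst _ 0); last by [].
    by apply: (near_inc _ (fun z => dotv (gz z) (pz z)) (fun=> 0)); apply: filterS near_rel => z [_ []].
  + have [] := has_slope_uniq (k := fun=> 0) _ (has_slope_dotv sg sx)
      (has_slope_cst _ 0); last by [].
    by apply: (near_inc _ (fun z => dotv (gz z) (xz z)) (fun=> 0)); apply: filterS near_rel => z [_ []].
  + have [] := has_slope_mx_uniq _ sp (has_slope_mxZ
      (has_slope_cst (param_increment tau) (- (eps ^+ 2)^-1)) (has_slope_mxM sw sg)).
      by apply: (near_inc _ pz (fun z => legendre I eps (gz z) (xz z))); apply: filterS near_rel => z [_ []].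
    by rewrite scale0r add0r.
  + by [].
- move=> i j; rewrite (ord1 j).
  apply: (slope_slope (h := fun z => pz z i 0) (k := fun z => Xz z i 0)).
  + by apply: filterS timez => z [/(_ i 0)].
  + exact: sXz i 0.
  + apply: filterS time_near_W => t Wt; exists ((phi (t, m)).1 i 0).
    by have [/(_ i 0)] := slope t Wt.
- move=> i j; rewrite (ord1 j).
  apply: (slope_slope (h := fun z => gz z i 0) (k := fun z => xz z i 0)).
  + by apply: filterS timez => z [_ /(_ i 0)].
  + exact: sx i 0.
  + apply: filterS time_near_W => t Wt; exists ((phi (t, m)).2 i 0).
    by have [_ /(_ i 0)] := slope t Wt.
Qed.

End Variation.

(** * Invariance of the volume form *)

Section VolumeForm.
Variables (R : realType) (k : nat).
Local Notation V := ('cV[R]_k.+1 * 'cV[R]_k.+1)%type.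

Lemma alternating_eq_det_cast M N (e : M = N) (F : form R 'rV[R]_N M)
    (v : 'I_M -> 'rV[R]_N) : multilinear F -> alternating F ->
  F v = \det (\matrix_i v (cast_ord (esym e) i)) *
        F (fun i => delta_mx 0 (cast_ord e i)).
Proof.
subst M => Fl Fa; rewrite (alternating_eq_det v Fl Fa); congr (\det _ * F _).
by apply/matrixP => i j; rewrite !mxE cast_ord_id.
Qed.

Definition frame_coords (E : 'M[R]_(k.+1, k)) (u : V) : 'rV[R]_(k + k) :=
  row_mx (u.1^T *m E) (u.2^T *m E).

Lemma muln2_addnn : (k * 2 = k + k)%N. Proof. by rewrite muln2 addnn. Qed.

Definition coords_mx (E : 'M[R]_(k.+1, k)) (xi : 'I_(k * 2) -> V) :
    'M[R]_(k + k) :=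
  \matrix_i frame_coords E (xi (cast_ord (esym muln2_addnn) i)).

(* The symplectic form only sees the coordinates in an orthonormal frame of the
   tangent space of the sphere, where it is the standard one. *)
Lemma wedge_power_symplectic : exists K : R, forall E g (xi : 'I_(k * 2) -> V),
  dotv g g = 1 -> is_frame E g -> (forall i, dotv g (xi i).2 = 0) ->
  wedge_power (@symplectic_form R k.+1) k xi = K * \det (coords_mx E xi).
Proof.
pose F := wedge_power (@std_symplectic R k) k.
(* The constant is the value on the standard basis and is left unevaluated: invariance only asks
   that it be the same at all points and in all frames. *)
exists (F (fun i => delta_mx 0 (cast_ord muln2_addnn i))) => E g xi gg fE gxi.
(* Momentum variations may have a component along [g], but they are only paired with position
   variations, which are orthogonal to it. *)
have dotE u w : dotv g w = 0 -> dotv u w = dotv (E^T *m u) (E^T *m w).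
  move=> gw; rewrite {1}(frame_decomp w gg fE) gw scale0r addr0.
  by rewrite dotv_mulmx.
have coordE u i : (u^T *m E) 0 i = (E^T *m u) i 0.
  by rewrite -[u^T *m E]trmxK trmx_mul trmxK mxE.
transitivity (F (fun i => frame_coords E (xi i))).
  apply: wedge_power_pullback => f; rewrite symplectic_formE /std_symplectic /=.
  rewrite (dotE _ _ (gxi (f 1))) (dotE _ _ (gxi (f 0))) !dotvE -sumrB; apply: eq_bigr => i _.
  by rewrite /frame_coords !row_mxEl !row_mxEr !coordE.
have Fl : multilinear F.
  exact: (wedge_power_multilinear (@std_symplectic_multilinear R k)).
have Fa : alternating F by exact: wedge_power_alternating.
by rewrite (alternating_eq_det_cast muln2_addnn _ Fl Fa) mulrC.
Qed.

Lemma has_slope_row_mx (P : Type) (d : increment R P) m n1 n2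
    (H : P -> 'M[R]_(m, n1)) (K : P -> 'M[R]_(m, n2)) L B L' B' :
  has_slope_mx d H L B -> has_slope_mx d K L' B' ->
  has_slope_mx d (fun z => row_mx (H z) (K z)) (row_mx L L') (row_mx B B').
Proof.
move=> hH hK i j; case: (split_ordP j) => l ->.
- by rewrite !row_mxEl; under [X in has_slope _ X]funext do rewrite row_mxEl.
- by rewrite !row_mxEr; under [X in has_slope _ X]funext do rewrite row_mxEr.
Qed.

Lemma has_slope_powR (h : R -> R) (tau b al : R) : 0 < h tau ->
  has_slope (time_increment tau) h (h tau) b ->
  has_slope (time_increment tau) (fun t => h t `^ al) (h tau `^ al)
    (al * h tau `^ (al - 1) * b).
Proof.
move=> h0 /has_slope_is_derive hd.
have dp := is_derive1_comp (is_derive1_powR al h0) hd.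
have idc : continuous (idfun : R -> R^o) by move=> z; exact: cvg_id.
exact: (is_derive_has_slope (l := idfun) idc dp).
Qed.

(** Since [g tau] is orthogonal to the frame, only the derivative of the factor g^T E survives; g +
    g0 = 2 g cancels the denominator 1 + 1. *)
Lemma transport_slope (E : 'M[R]_(k.+1, k)) (g : R -> 'cV[R]_k.+1) tau x :
  dotv (g tau) (g tau) = 1 -> is_frame E (g tau) ->
  has_slope_mx (time_increment tau) g (g tau) x ->
  has_slope_mx (time_increment tau) (fun t => transport E (g tau) (g t)) E
    (- (g tau *m (x^T *m E))).
Proof.
move=> gg [EE Eg] sg; set g0 := g tau in gg Eg sg *.
have gE : g0^T *m E = 0 by rewrite -[LHS]trmxK trmx_mul trmxK Eg trmx0.
have s1 := has_slopeD (has_slope_cst (time_increment tau) 1)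
  (has_slope_dotv (has_slope_mx_cst (time_increment tau) g0) sg).
have s2 := has_slope_mxM (has_slope_mxD sg (has_slope_mx_cst (time_increment tau) g0))
  (has_slope_mxM (has_slope_mx_tr sg) (has_slope_mx_cst (time_increment tau) E)).
have ne : 1 + dotv g0 g0 != 0 by rewrite gg (_ : 1 + 1 = 2)// pnatr_eq0.
apply: (has_slope_mx_eq (has_slope_mxD (has_slope_mx_cst (time_increment tau) E)
  (has_slope_mxN (has_slope_mxZ (has_slopeV ne s1) s2)))).
  by rewrite gE mulmx0 scaler0 subr0.
rewrite gE !mulmx0 scaler0 !add0r addr0 -mulr2n gg; congr (- _).
rewrite -[g0 *+ 2]scaler_nat -scalemxAl scalerA (_ : 1 + 1 = 2)//.
by rewrite mulVf ?pnatr_eq0// scale1r.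
Qed.

End VolumeForm.

(** * The density along a trajectory *)

Section Invariance.
Variables (R : realType) (k : nat).
Variables (I : {linear 'M[R]_k.+1 -> 'M[R]_k.+1}) (eps : R).
Hypotheses (HI : inertia_operator I) (eps0 : eps != 0).
Local Notation V := ('cV[R]_k.+1 * 'cV[R]_k.+1)%type.

(** The frame moves along [g0], which theta g0 g0 annihilates on both sides, so only the derivative
    of theta itself remains. *)
Lemma frame_inertia_slope (P : Type) (d : increment R P)
    (E : P -> 'M[R]_(k.+1, k)) (g : P -> 'cV[R]_k.+1) E0 g0 x :
  has_slope_mx d g g0 x -> has_slope_mx d E E0 (- (g0 *m (x^T *m E0))) ->
  has_slope_mx d (fun z => frame_inertia I (E z) (g z)) (frame_inertia I E0 g0)
    (- (E0^T *m theta I g0 x *m E0 + (E0^T *m theta I g0 x *m E0)^T)).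
Proof.
move=> sg sE; have sT := has_slope_mx_theta I sg sg.
apply: (has_slope_mx_eq (has_slope_mxN
  (has_slope_mxM (has_slope_mxM (has_slope_mx_tr sE) sT) sE))) => //.
have tg : theta I g0 g0 *m g0 = 0 by exact: theta_mul_same.
have gt : g0^T *m theta I g0 g0 = 0.
  by rewrite -(theta_tr HI) -trmx_mul tg trmx0.
congr (- _); rewrite !trmx_mul trmxK (theta_tr HI) linearN/= !trmx_mul !trmxK.
rewrite !mulmxN !mulNmx -!(mulmxA _ g0^T) gt mulmx0 oppr0 add0r.
rewrite (mulmxA _ g0) -(mulmxA _ _ g0) tg mulmx0 mul0mx oppr0 addr0.
by rewrite mulmxDr mulmxDl addrC mulmxA.
Qed.

Variables (W : set (R * V)) (phi : R * V -> V).
Hypothesis phi_flow :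
  local_flow (@cotangent_sphere R k.+1) (rubber_ball_field I eps) W phi.
Variables (m : V) (v : 'I_(k * 2) -> V).
Hypotheses (Mm : cotangent_sphere m)
  (Tv : forall i, tangent_cotangent_sphere m (v i)).
Let xi t i : V := 'd (fun y => phi (t, y)) m (v i).
Let f t := chaplygin_volume I eps (phi (t, m)) (xi t).

(** Near [tau] the density is written in the frame transported from time [tau]. Both of its factors
    have the same formula in every orthonormal frame, so a fresh start at each instant is
    legitimate. *)
Lemma volume_slope tau : W (tau, m) -> has_slope (time_increment tau) f (f tau) 0.
Proof.
move=> Wm; set p := (phi (tau, m)).1; set g := (phi (tau, m)).2.
set x := X_gamma I eps p g.
have [gg gp] : cotangent_sphere (phi (tau, m)) := flow_mem phi_flow Mm Wm.
have [E0 fE0] := exists_frame gg.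
have [_ sg] := flow_time_slope phi_flow Mm Wm.
pose ga t := (phi (t, m)).2; rewrite -/(ga tau) in gg gp fE0 sg.
pose E t := transport E0 (ga tau) (ga t).
have sE : has_slope_mx (time_increment tau) E E0 (- (g *m (x^T *m E0))).
  exact: transport_slope gg fE0 sg.
have sB := frame_inertia_slope sg sE.
have [Z [trZ ZE]] := linearization HI
  ((eps - 1) / eps ^+ 3 * dotv (I (wedgev g x) *m x) g - dotv x p)
  p x eps0 gg fE0.
have sC : has_slope_mx (time_increment tau) (fun t => coords_mx (E t) (xi t))
    (coords_mx E0 (xi tau)) (coords_mx E0 (xi tau) *m Z).
  move=> i; set i' := cast_ord (esym (muln2_addnn k)) i.
  have [dx [dp [a [[h1 h2 h3 h4 h5] [sp sx]]]]] :=
    variation HI eps0 phi_flow Mm (Tv i') Wm.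
  rewrite -/p -/g -/x in h1 h2 h3 h4 h5.
  have ZEi := ZE _ _ _ _ _ h1 h2 h3 h4 h5.
  have sr := has_slope_row_mx (has_slope_mxM (has_slope_mx_tr sp) sE)
    (has_slope_mxM (has_slope_mx_tr sx) sE).
  have sr' : has_slope_mx (time_increment tau)
      (fun t => frame_coords (E t) (xi t i')) (frame_coords E0 (xi tau i'))
      (frame_coords E0 (xi tau i') *m Z).
    apply: (has_slope_mx_eq sr); first by [].
    by rewrite -[RHS]ZEi; congr (row_mx (_ + _) (_ + _)); rewrite mulmxN.
  have cE E' t j : coords_mx E' (xi t) i j = frame_coords E' (xi t i') 0 j.
    by rewrite mxE.
  move=> j; have srj := sr' 0 j.
  have fE : (fun t => coords_mx (E t) (xi t) i j)
      = (fun t => frame_coords (E t) (xi t i') 0 j).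
    by apply/funext => t; exact: cE.
  rewrite fE; apply: (has_slope_eq srj); first by rewrite cE.
  rewrite [LHS]mxE [RHS]mxE; apply: eq_bigr => l _.
  by rewrite cE.
have sdB := has_slope_det sB; have sdC := has_slope_det sC.
have dB0 := det_frame_inertia_gt0 HI gg fE0.
set al := (2 * eps)^-1 - 1.
have [K KP] := wedge_power_symplectic R k.
pose b t := \det (frame_inertia I (E t) (ga t)).
have Etau : E tau = E0.
  have gE : (ga tau)^T *m E0 = 0.
    by rewrite -[LHS]trmxK trmx_mul trmxK fE0.2 trmx0.
  by rewrite /E /transport gE mulmx0 scaler0 subr0.
have sbal : has_slope (time_increment tau) (fun t => b t `^ al) (b tau `^ al)
    (al * b tau `^ (al - 1) * \tr (- (E0^T *m theta I g x *m E0 +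
      (E0^T *m theta I g x *m E0)^T) *m \adj (frame_inertia I E0 g))).
  by apply: has_slope_powR; rewrite /b Etau.
have sf := has_slopeM sbal (has_slopeM (has_slope_cst (time_increment tau) K) sdC).
have near_f : \forall t \near tau,
    b t `^ al * (K * \det (coords_mx (E t) (xi t))) = f t.
  have near_W : \forall t \near tau, W (t, m).
    have := open_nbhs_nbhs (conj (flow_open phi_flow) Wm).
    move=> /nbhs_ballP[e /= e0 He]; apply/nbhs_ballP; exists e => //= t te.
    by apply: He; split=> //; exact: ballxx.
  (* Transport breaks down only at the antipode of the position at [tau], which continuity excludes
     nearby. *)
  have near_ne : \forall t \near tau, 1 + dotv (ga tau) (ga t) != 0.
    have [hd _] := has_slope_is_derive (f := fun t => 1 + dotv (ga tau) (ga t))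
      (has_slopeD (has_slope_cst (time_increment tau) 1)
        (has_slope_dotv (has_slope_mx_cst (time_increment tau) (ga tau)) sg)).
    move/derivable1_diffP: hd => /differentiable_continuous hc.
    apply: (@cvgr_neq0 _ _ _ _ _ _ _ hc).
    by rewrite gg (_ : 1 + 1 = 2)// pnatr_eq0.
  apply: filterS2 near_W near_ne => t Wt ne.
  have [ggt _] : cotangent_sphere (phi (t, m)) := flow_mem phi_flow Mm Wt.
  have fEt : is_frame (E t) (ga t) by exact: transport_frame.
  have txi i : dotv (ga t) (xi t i).2 = 0.
    by have [dx [dp [a [[h1 _ _ _ _] _]]]] := variation HI eps0 phi_flow Mm (Tv i) Wt.
  rewrite /b -(det_v_frame HI ggt fEt) -(KP _ _ _ ggt fEt txi).
  by [].
have ftau := nbhs_singleton near_f.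
apply: (has_slope_near (time_near near_f)).
apply: (has_slope_eq sf).
  by rewrite -ftau /= Etau.
rewrite mul0r add0r /b Etau.
set B := frame_inertia I E0 g; set C := coords_mx E0 (xi tau).
set Q := E0^T *m theta I g x *m E0 in trZ *.
have Bu : B \in unitmx by rewrite unitmxE unitfE gt_eqF.
have adjB : \adj B = \det B *: invmx B.
  by rewrite /invmx Bu scalerA mulfV ?scale1r// gt_eqF.
have trC : \tr (C *m Z *m \adj C) = \det C * \tr Z.
  by rewrite mxtrace_mulC mulmxA mul_adj_mx mul_scalar_mx linearZ.
have trQ : \tr (Q^T *m invmx B) = \tr (Q *m invmx B).
  rewrite -mxtrace_tr trmx_mul trmxK trmx_inv frame_inertia_sym//.
  by rewrite mxtrace_mulC.
rewrite trC adjB -scalemxAr mulNmx mulmxDl linearZ linearN/= linearD/= trQ trZ.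
(* With this factor exposed both terms share the powers of det B, and the coefficients add up to - 2
   al + (1 - 2 eps) / eps = 0. *)
have -> : \det B `^ al = \det B `^ (al - 1) * \det B.
  transitivity (\det B `^ (al - 1 + 1)); first by rewrite subrK.
  have Dn : \det B != 0 by rewrite gt_eqF.
  by rewrite powRD ?Dn ?implybT// powRr1// ltW.
rewrite /al; field; exact: eps0.
Qed.

(** The slope vanishes on the whole time segment from 0 to t, which [flow_interval] keeps in the
    domain, so the density is constant; at time 0 the flow fixes tangent vectors. *)
Lemma flow_preserves_volume t : W (t, m) ->
  chaplygin_volume I eps (phi (t, m)) (fun i => 'd (fun y => phi (t, y)) m (v i))
  = chaplygin_volume I eps m v.
Proof.
move=> Wt; have Wseg s : Num.min 0 t <= s <= Num.max 0 t -> W (s, m).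
  (* Points of the segment are written as (s / t) t with s / t in [0, 1], so t = 0 is treated
     apart. *)
  have [->|t0] := eqVneq t 0.
    rewrite minxx maxxx => /le_anti <-.
    by have := flow_interval phi_flow Mm Wt (a := 0); rewrite mul0r; apply; rewrite lexx ler01.
  move=> st; rewrite -(divfK t0 s); apply: (flow_interval phi_flow Mm Wt).
  move: st; case: (leP 0 t) => h /andP[s1 s2].
    have tpos : 0 < t by rewrite lt0r t0.
    by rewrite divr_ge0//= ler_pdivrMr// mul1r.
  by rewrite mulr_le0 ?invr_le0 ?(ltW h)//= ler_ndivrMr// mul1r.
have [s sP E] := MVT_between (f := f) (f' := fun=> 0) (a := 0) (b := t)
  (fun s sP => has_slope_is_derive (volume_slope (Wseg s sP))).
have W0 : W (0, m) by apply: Wseg; rewrite ge_min le_max lexx.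
transitivity (f t) => //.
transitivity (f 0); first by apply/eqP; rewrite -subr_eq0 E mul0r.
rewrite /f; have -> : phi (0, m) = m by exact: (flow_init phi_flow Mm W0).
congr (chaplygin_volume _ _ _ _); apply/funext => i.
have [mu [mu0 Mmu mu1 mu2]] := exists_curve Mm (Tv i).
rewrite -mu0 in mu1 mu2 W0.
by have := flow_diff_init phi_flow mu1 mu2 Mmu W0; rewrite mu0.
Qed.

End Invariance.

(** * The shifted inertia operator and the conclusion *)

Section ShiftedInertia.
Variables (R : realType) (n : nat) (J : {linear 'M[R]_n -> 'M[R]_n}) (D : R).

Fact shifted_inertia_is_linear : linear (shifted_inertia J D).
Proof.
move=> a A B; rewrite /shifted_inertia linearP !scalerDr addrACA.
by rewrite !scalerA mulrC.
Qed.

HB.instance Definition _ := GRing.isLinear.Build R 'M[R]_n 'M[R]_n *:%R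
  (shifted_inertia J D) shifted_inertia_is_linear.

Lemma so_dot_ge0 (A : 'M[R]_n) : so A -> 0 <= so_dot A A.
Proof.
move=> sA; rewrite /so_dot -mulrN -linearN/= -mulmxN -(sA : A^T = - A).
rewrite mulr_ge0 ?invr_ge0// sumr_ge0// => i _; rewrite mxE sumr_ge0// => j _.
by rewrite mxE -expr2 sqr_ge0.
Qed.

Lemma shifted_inertia_operator : inertia_operator J -> 0 < D ->
  inertia_operator (shifted_inertia J D).
Proof.
move=> [J1 J2 J3] D0.
have dE A B : so_dot (shifted_inertia J D A) B = so_dot (J A) B + D * so_dot A B.
  rewrite /so_dot /shifted_inertia mulmxDl -scalemxAl mxtraceD mxtraceZ; ring.
split=> [A sA|A B sA sB|A sA A0].
- rewrite /so/= /shifted_inertia linearD linearZ/=.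
  by rewrite (J1 A sA : _ = _) (sA : A^T = - A) scalerN opprD.
- by rewrite dE J2// [RHS]so_dotC dE so_dotC (so_dotC B).
- by rewrite dE ltr_wpDr ?J3// mulr_ge0 ?so_dot_ge0// ltW.
Qed.

End ShiftedInertia.

Lemma rolling_ratio_neq0 (R : realType) (rho sigma eps : R) :
  0 < rho -> 0 < sigma -> rolling_ratio rho sigma eps -> eps != 0.
Proof.
move=> r0 s0 [->|[sr ->]]; apply: mulf_neq0; rewrite ?invr_eq0 ?(gt_eqF s0)//.
- by rewrite gt_eqF ?addr_gt0.
- by rewrite subr_eq0.
Qed.

Theorem theorem10 (R : realType) (n : nat)
    (J : {linear 'M[R]_n -> 'M[R]_n}) (D rho sigma eps : R)
    (J_inertia : inertia_operator J) (D_gt0 : 0 < D)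
    (rho_gt0 : 0 < rho) (sigma_gt0 : 0 < sigma)
    (eps_ratio : rolling_ratio rho sigma eps) :
  flow_preserves (@cotangent_sphere R n) (@tangent_cotangent_sphere R n)
    (rubber_ball_field (shifted_inertia J D) eps)
    (chaplygin_volume (shifted_inertia J D) eps).
Proof.
move=> W phi phi_flow t m Mm Wt v Tv.
have eps0 := rolling_ratio_neq0 rho_gt0 sigma_gt0 eps_ratio.
(* For n = 0 the phase space is empty, as the empty vector does not have norm 1; otherwise n is a
   successor, and frames have one column fewer than rows. *)
case: n J J_inertia W phi phi_flow m Mm Wt v Tv =>
    [|k] J HJ W phi phi_flow m Mm Wt v Tv.
  by case: Mm; rewrite dotvE big_ord0 => /eqP; rewrite eq_sym oner_eq0.
exact: (flow_preserves_volume (shifted_inertia_operator HJ D_gt0) eps0 phi_flow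
  Mm Tv Wt).
Qed.
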